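(* Let $0<r<\infty$. Let $(S,M)$ be a compact whole punctured surface, $\phi$ an open boundary parametrization of it (every parametrized boundary component is an interval), and $K_\bullet$ a $\phi$-admissible PLCW decomposition of $S$ with $M=K_0\setminus\partial S$. Let $\Gamma_K$ be the dual graph of $K_\bullet$. The construction assigning to a marking of $K_\bullet$ the induced $\Lambda_r$-structure on $\Gamma_K$ defines a bijection $$\Lambda_r(\Gamma_K)^S_{/\sim_{\mathrm{iso}}}\;\cong\;\mathcal{M}^K(S,M)_{/\sim_{\mathrm{fix}}}$$ between isomorphism classes of $\Lambda_r$-structures on $\Gamma_K$ inducing the cyclic orders given by the surface, and admissible markings of $K_\bullet$ modulo the fixed PLCW moves.
   Context: **Surfaces.** A punctured surface $(S,M)$ is an oriented smooth 2-manifold with corners $S$, whose boundary is the union of parametrized and free boundary faces (alternating at corners), with a finite set $M\subset S\setminus\partial S$ of punctures. It is whole if no boundary circle is entirely free. Parametrized components are divided into ingoing and outgoing ones. **Marked PLCW decompositions.** A PLCW decomposition $K_\bullet$ is a decomposition into cells (vertices $K_0$, edges $K_1$, polygonal faces $K_2$; sides of a polygon may be identified) such that characteristic maps of faces restrict on sides and corners to characteristic maps of edges and vertices. It is $\phi$-admissible if $M\subset K_0$ and each parametrized interval is one edge (with its endpoints as vertices). $\overline K_1$ is the set of edges not in the free boundary. A marking consists of an orientation of each $e\in\overline K_1$, a label $s_e\in\mathbb{Z}/r$ for each $e\in\overline K_1$, and a marked side for each face. $\mathcal{M}^K(S,M)$ is the set of admissible markings; since here all interior vertices are punctures and there are no closed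 parametrized components, every marking is admissible. $\sim_{\mathrm{fix}}$ is generated by the fixed PLCW moves: (1) reverse an edge, replacing $s_e$ by $-s_e-1$; (2) move the marking of a face from a side $e$ to the counterclockwise next side, replacing $s_e$ by $s_e-1$ if the face lies to the left of $e$ and by $s_e+1$ if it lies to the right (no change of labels if $e$ is in the free boundary); (3) deck transformations of a face by $k\in\mathbb{Z}/r$: add $k$ to $s_e$ for sides with the face on the left of $e$, $-k$ for sides with the face on the right (an edge with the face on both sides is unchanged). **Graphs.** A graph $\Gamma$ consists of finite sets $H$ (half-edges), $V$ (vertices), an involution of $H$ and a map $s:H\to V$ with all fibres $H_v=s^{-1}(v)$ non-empty; two-element orbits are edges, fixed points are external half-edges. The category $A(\Gamma)$ has objects the vertices, edges and external half-edges, and one non-identity morphism for each half-edge $h$, from $s(h)$ to the edge containing $h$ (or to $h$ if external). Given a partition of the external half-edges into incoming and outgoing ones, $A_\Gamma:A(\Gamma)\to\mathrm{Set}$ sends $v\mapsto H_v$, $e=\{h,h'\}\mapsto\{h,h'\}$, external $h\mapsto\{0,1\}$. The morphism of $h$ in an edge $\{h,h'\}$ goes to the map $H_{s(h)}\to\{h,h'\}$ with $h\mapsto h'$ and $k\mapsto h$ for $k\ne h$; that of an incoming external $h$ to $h\mapsto1$, $k\mapsto0$ ($k\neq h$); that of an outgoing one to $h\mapsto0$, $k\mapsto1$. **The $r$-cyclic category.** $\Lambda_r$ has objects $[n]_r$, $n\ge0$, and is generated by the morphisms $\delta_i^n,\sigma_i^n$ of the simplex category $\Delta$ with their usual relations and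 automorphisms $\tau_n$ of $[n]_r$ with $\tau_n\delta_i^n=\delta_{i-1}^n\tau_{n-1}$ ($1\le i\le n$), $\tau_n\delta_0^n=\delta_n^n$, $\tau_n\sigma_i^n=\sigma_{i-1}^n\tau_{n+1}$ ($1\le i\le n$), $\tau_n\sigma_0^n=\sigma_n^n\tau_{n+1}^2$, $\tau_n^{r(n+1)}=1$. The functor $\lambda_r:\Lambda_r\to\mathrm{Set}$ sends $[n]_r$ to $\{0,\dots,n\}$, morphisms of $\Delta$ to the underlying maps, and $\tau_n$ to $i\mapsto i-1$ mod $n+1$. Let $\phi^n_n,\phi^0_n:[n]_r\to[1]_r$ be the images of the maps of $\Delta$ given by $\phi^n_n(k)=1$ iff $k=n$ and $\phi^0_n(k)=0$ iff $k=0$, and put $\psi_n^{k,n}=\phi^n_n\tau_n^{k-n}$, $\psi_n^{k,0}=\phi^0_n\tau_n^k$. **$\Lambda_r$-structures.** A $\Lambda_r$-structure on $\Gamma$ is a functor $\tilde A:A(\Gamma)\to\Lambda_r$ with a natural isomorphism $\mu:\lambda_r\tilde A\Rightarrow A_\Gamma$ whose components at external half-edges are $\mathrm{id}_{\{0,1\}}$. An isomorphism $(\tilde A,\mu)\to(\tilde B,\nu)$ is a natural isomorphism $\theta:\tilde A\Rightarrow\tilde B$ with $\nu\circ\lambda_r(\theta)=\mu$ that is the identity of $[1]_r$ at external half-edges. For $\Gamma$ embedded in the oriented surface $S$, $\Lambda_r(\Gamma)^S$ is the set of $\Lambda_r$-structures such that for each vertex $v$ the bijection $\mu_v:\{0,\dots,n\}\to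 H_v$ carries the standard cyclic order to the counterclockwise cyclic order on $H_v$. **Dual graph and construction.** The dual graph $\Gamma_K$ has vertices $K_2$ and half-edges the sides of faces lying in $\overline K_1$; two sides of the same interior edge form an edge, and parametrized boundary edges give external half-edges (incoming/outgoing accordingly). It embeds in $S\setminus M$ through the barycentric subdivision. Given a marking, orient (by move (1)) ingoing boundary edges with $S$ on the right and outgoing ones with $S$ on the left. The induced $\Lambda_r$-structure sends a face with $n+1$ sides in $\overline K_1$ to $[n]_r$, $\mu_v$ enumerating these sides counterclockwise starting at the marked side (or the first following one in $\overline K_1$), and all edges and external half-edges to $[1]_r$, with $\mu_e(0)$, $\mu_e(1)$ the half-edge on the right, left of an interior edge $e$. The morphism of the $k$-th side ($0\le k\le n$), lying on edge $e$, goes to $\psi_n^{k,n}\tau_n^{-(n+1)s_e}$ if the face is on the right of $e$ (interior or ingoing $e$), to $\psi_n^{k,0}$ if $e$ is interior and the face is on its left, and to $\psi_n^{k,0}\tau_n^{(n+1)(s_e+1)}$ if $e$ is outgoing. *)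

(* Defs.v *)
From Stdlib Require Import Relations.
From mathcomp Require Import all_boot all_algebra.
From mathcomp Require Import zify.

Set Implicit Arguments.
Unset Strict Implicit.
Unset Printing Implicit Defensive.

Import GRing.Theory.

(** * Categories *)

(* Hom-sets are setoids: [heq] is the equality of morphisms.  This allows
   categories presented by generators and relations without quotient types. *)
Record category := Category {
  ob :> Type;
  hom : ob -> ob -> Type;
  heq : forall a b, hom a b -> hom a b -> Prop;
  idm : forall a, hom a a;
  mcomp : forall a b d, hom b d -> hom a b -> hom a d;
  heq_refl : forall a b (f : hom a b), heq f f;
  heq_sym : forall a b (f g : hom a b), heq f g -> heq g f;
  heq_trans : forall a b (f g h : hom a b), heq f g -> heq g h -> heq f h;
  mcomp_heq : forall a b c (f f' : hom b c) (g g' : hom a b),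
    heq f f' -> heq g g' -> heq (mcomp f g) (mcomp f' g');
  mcompA : forall a b c d (f : hom c d) (g : hom b c) (h : hom a b),
    heq (mcomp f (mcomp g h)) (mcomp (mcomp f g) h);
  mcomp1m : forall a b (f : hom a b), heq (mcomp (idm b) f) f;
  mcompm1 : forall a b (f : hom a b), heq (mcomp f (idm a)) f
}.

Arguments hom {_} _ _.
Arguments heq {_ _ _} _ _.
Arguments idm {_} _.
Arguments mcomp {_ _ _ _} _ _.
Arguments heq_refl {_ _ _} _.

Notation "f =h g" := (heq f g) (at level 70).
Notation "f ** g" := (mcomp f g) (at level 40, left associativity).

Definition is_iso (C : category) (a b : C) (f : hom a b) : Prop :=
  exists g : hom b a, (g ** f =h idm a) /\ (f ** g =h idm b).

(* [f] is an identity; its source and target need only be provably equal. *)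
Variant is_identity (C : category) (a : C) : forall b : C, hom a b -> Prop :=
  IsIdentity (f : hom a a) of f =h idm a : is_identity f.

Record functor (C D : category) := Functor {
  fob :> C -> D;
  fmap : forall a b, hom a b -> hom (fob a) (fob b);
  fmap_heq : forall a b (f g : hom a b), f =h g -> fmap f =h fmap g;
  fmap1 : forall a, fmap (idm a) =h idm (fob a);
  fmapM : forall a b c (f : hom b c) (g : hom a b),
    fmap (f ** g) =h fmap f ** fmap g
}.

Arguments fmap {C D} _ {a b} _.

Definition fcomp (C D E : category) (G : functor D E) (F : functor C D) :
  functor C E.
Proof.
exists (fun a => G (F a)) (fun a b f => fmap G (fmap F f)).
- by move=> a b f g efg; do 2!apply: fmap_heq.
- by move=> a; apply: heq_trans (fmap1 _ _); apply/fmap_heq/fmap1.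
- by move=> a b c f g; apply: heq_trans (fmapM _ _ _); apply/fmap_heq/fmapM.
Defined.

Record nattrans (C D : category) (F G : functor C D) := NatTrans {
  ncomp :> forall a, hom (F a) (G a);
  ncompE : forall a b (f : hom a b),
    ncomp b ** fmap F f =h fmap G f ** ncomp a
}.

Definition nat_iso (C D : category) (F G : functor C D) (eta : nattrans F G) :=
  forall a, is_iso (eta a).

Definition SET : category.
Proof.
exists Type (fun X Y => X -> Y) (fun X Y f g => f =1 g)
  (fun X => @id X) (fun X Y Z f g => f \o g) => //.
- by move=> X Y f g e x.
- by move=> X Y f g h e e' x; rewrite e.
- by move=> X Y Z f f' g g' e e' x; rewrite /= e' e.
Defined.

(** * The r-cyclic category *)

Record dmap (n m : nat) := DMap {
  dfun :> 'I_n.+1 -> 'I_m.+1;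
  dmono : forall i j : 'I_n.+1, i <= j -> dfun i <= dfun j
}.

Lemma coface_mono n (i : 'I_n.+2) (j k : 'I_n.+1) :
  j <= k -> lift i j <= lift i k.
Proof. by rewrite /= leq_bump2. Qed.

Definition coface n (i : 'I_n.+2) : dmap n n.+1 := DMap (coface_mono i).

Definition codeg_fun n (i : 'I_n.+1) (j : 'I_n.+2) : 'I_n.+1 :=
  inord (if j <= i then j : nat else j.-1).

Lemma codeg_funE n (i : 'I_n.+1) (j : 'I_n.+2) :
  codeg_fun i j = (if j <= i then j : nat else j.-1) :> nat.
Proof.
rewrite /codeg_fun inordK //; case: i j => [i ?] [j ?] /=.
by case: (leqP j i); lia.
Qed.

Lemma codeg_mono n (i : 'I_n.+1) (j k : 'I_n.+2) :
  j <= k -> codeg_fun i j <= codeg_fun i k.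
Proof. by rewrite !codeg_funE => lejk; case: (leqP k i); case: (leqP j i); lia. Qed.

Definition codeg n (i : 'I_n.+1) : dmap n.+1 n := DMap (@codeg_mono n i).

Lemma phi_last_mono n (i j : 'I_n.+1) : i <= j ->
  (inord (i == n :> nat) : 'I_2) <= (inord (j == n :> nat) : 'I_2).
Proof.
by rewrite !inordK ?ltnS ?leq_b1 //; case: i j => [i ?] [j ?] /=; lia.
Qed.

(* [phi_last k = 1] iff [k = n], and [phi_first k = 0] iff [k = 0] *)
Definition phi_last n : dmap n 1 := DMap (@phi_last_mono n).

Lemma phi_first_mono n (i j : 'I_n.+1) : i <= j ->
  (inord (i != 0 :> nat) : 'I_2) <= (inord (j != 0 :> nat) : 'I_2).
Proof.
by rewrite !inordK ?ltnS ?leq_b1 //; case: i j => [i ?] [j ?] /=; lia.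
Qed.

Definition phi_first n : dmap n 1 := DMap (@phi_first_mono n).

Inductive word : nat -> nat -> Type :=
| wid n : word n n
| wcomp n m p : word m p -> word n m -> word n p
| wdelta n m : dmap n m -> word n m
| wtau n : word n n
| wtauV n : word n n.

Fixpoint tauX n (k : nat) : word n n :=
  if k is k'.+1 then wcomp (wtau n) (tauX n k') else wid n.

Fixpoint tauVX n (k : nat) : word n n :=
  if k is k'.+1 then wcomp (wtauV n) (tauVX n k') else wid n.

Definition tauZ n (z : int) : word n n :=
  match z with Posz k => tauX n k | Negz k => tauVX n k.+1 end.

(* The least congruence making words a category in which the morphisms of the
   simplex category compose as there, and the cyclic relations hold. *)
Inductive weq (r : nat) : forall n m, word n m -> word n m -> Prop :=
| weq_refl n m (f : word n m) : weq r f f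
| weq_sym n m (f g : word n m) : weq r f g -> weq r g f
| weq_trans n m (f g h : word n m) : weq r f g -> weq r g h -> weq r f h
| weq_comp n m p (f f' : word m p) (g g' : word n m) :
    weq r f f' -> weq r g g' -> weq r (wcomp f g) (wcomp f' g')
| weq_A n m p q (f : word p q) (g : word m p) (h : word n m) :
    weq r (wcomp f (wcomp g h)) (wcomp (wcomp f g) h)
| weq_1m n m (f : word n m) : weq r (wcomp (wid m) f) f
| weq_m1 n m (f : word n m) : weq r (wcomp f (wid n)) f
| weq_delta1 n (f : dmap n n) : f =1 id -> weq r (wdelta f) (wid n)
| weq_deltaM n m p (f : dmap m p) (g : dmap n m) (h : dmap n p) :
    h =1 f \o g -> weq r (wcomp (wdelta f) (wdelta g)) (wdelta h)
| weq_tauK n : weq r (wcomp (wtauV n) (wtau n)) (wid n)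
| weq_tauVK n : weq r (wcomp (wtau n) (wtauV n)) (wid n)
| weq_tau_coface n (i j : 'I_n.+2) : i = j.+1 :> nat ->
    weq r (wcomp (wtau n.+1) (wdelta (coface i)))
          (wcomp (wdelta (coface j)) (wtau n))
| weq_tau_coface0 n :
    weq r (wcomp (wtau n.+1) (wdelta (coface ord0)))
          (wdelta (@coface n ord_max))
| weq_tau_codeg n (i j : 'I_n.+1) : i = j.+1 :> nat ->
    weq r (wcomp (wtau n) (wdelta (codeg i)))
          (wcomp (wdelta (codeg j)) (wtau n.+1))
| weq_tau_codeg0 n :
    weq r (wcomp (wtau n) (wdelta (codeg ord0)))
          (wcomp (wdelta (@codeg n ord_max)) (tauX n.+1 2))
| weq_tau_order n : weq r (tauX n (r * n.+1)) (wid n).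

Definition Lambda (r : nat) : category.
Proof.
exists nat word (@weq r) wid wcomp.
- exact: weq_refl.
- exact: weq_sym.
- exact: weq_trans.
- exact: weq_comp.
- exact: weq_A.
- exact: weq_1m.
- exact: weq_m1.
Defined.

(* [ord_pred] is [i |-> i - 1] modulo [n + 1], and [ordS] its inverse *)
Fixpoint word_fun n m (f : word n m) : 'I_n.+1 -> 'I_m.+1 :=
  match f with
  | wid _ => id
  | wcomp _ _ _ f g => word_fun f \o word_fun g
  | wdelta _ _ f => f
  | wtau n => @ord_pred n.+1
  | wtauV n => @ordS n.+1
  end.

Lemma tauX_funE n k (i : 'I_n.+1) :
  word_fun (tauX n k) i = (i + k * n) %% n.+1 :> nat.
Proof.
elim: k => [|k IHk] /=; first by rewrite addn0 modn_small.
rewrite IHk addnS /= modnDml; congr (_ %% _); lia.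
Qed.

Lemma ord_predE n (i : 'I_n.+1) :
  ord_pred i = (if i == 0 :> nat then n else i.-1) :> nat.
Proof.
case: i => [[|i] ltin] /=; first by rewrite modn_small.
by rewrite modnDr modn_small //; lia.
Qed.

Lemma word_fun_weq r n m (f g : word n m) :
  weq r f g -> word_fun f =1 word_fun g.
Proof.
have liftE p (a : 'I_p.+1) (b : 'I_p) : lift a b = bump a b :> nat by [].
elim=> {n m f g} //=.
- by move=> n m f g _ e x.
- by move=> n m f g h _ e _ e' x; rewrite e.
- by move=> n m p f f' g g' _ e _ e' x; rewrite /= e' e.
- by move=> n m p f g h e x; rewrite /= e.
- by move=> n x; rewrite /= ord_predK.
- by move=> n x; rewrite /= ordSK.
- move=> n i j eij x; apply: ord_inj.
  rewrite /comp !liftE !ord_predE !liftE /bump.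
  by case: i j x eij => [i ?] [j ?] [[|x] ?] /= e; do ?case: ifP; lia.
- move=> n x; apply: ord_inj.
  rewrite /comp !liftE !ord_predE !liftE /bump /=.
  by case: x => [x ?] /=; lia.
- move=> n i j eij x; apply: ord_inj.
  rewrite /comp !ord_predE !codeg_funE !ord_predE.
  by case: i j x eij => [i ?] [j ?] [[|x] ?] /= e; do ?case: ifP; lia.
- move=> n x; apply: ord_inj.
  rewrite /comp !ord_predE !codeg_funE !ord_predE /=.
  by case: x => [[|[|x]] ?] /=; do ?case: ifP; lia.
- move=> n x; apply: ord_inj; rewrite tauX_funE mulnAC addnC modnMDl.
  by rewrite modn_small.
Qed.

Definition lambda (r : nat) : functor (Lambda r) SET.
Proof.
exists (fun n : nat => 'I_n.+1 : Type) word_fun => //.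
exact: word_fun_weq.
Defined.

(** * Graphs *)

Record graph := Graph {
  halfedge : finType;
  gvertex : finType;
  ginv : halfedge -> halfedge;
  gsrc : halfedge -> gvertex;
  ginvK : involutive ginv;
  gsrc_surj : forall v, exists h, gsrc h = v;
  (* on two-element orbits of [ginv] the value of [incoming] is irrelevant *)
  incoming : halfedge -> bool
}.

Definition is_gedge (G : graph) (E : {set halfedge G}) : bool :=
  [exists h, (ginv h != h) && (E == [set h; ginv h])].

Notation gedge G := {E : {set halfedge G} | is_gedge E}.
Notation external G := {h : halfedge G | ginv h == h}.
Notation star G v := {h : halfedge G | gsrc h == v}.

Inductive Aob (G : graph) : Type :=
| Avert of gvertex G
| Aedge of gedge G
| Aext of external G.

Inductive Ahom (G : graph) : Aob G -> Aob G -> Type :=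
| Aid x : Ahom x x
| Ainc (h : halfedge G) (e : gedge G) of h \in val e :
    Ahom (Avert (gsrc h)) (Aedge e)
| Aincx (h : external G) : Ahom (Avert (gsrc (val h))) (Aext h).

(* Only composites with an identity exist. *)
Definition Acomp (G : graph) (x y z : Aob G) (f : Ahom y z) (g : Ahom x y) :
    Ahom x z :=
  match g in Ahom x y return Ahom y z -> Ahom x z with
  | Aid _ => id
  | Ainc h e he => fun f =>
      match f in Ahom y z return
        (if y is Aedge e' then h \in val e' -> Ahom (Avert (gsrc h)) z else unit)
      with
      | Aid y => if y is Aedge e' then @Ainc G h e' else tt
      | Ainc _ _ _ | Aincx _ => tt
      end he
  | Aincx h => fun f =>
      match f in Ahom y z return
        (if y is Aext h' then Ahom (Avert (gsrc (val h'))) z else unit)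
      with
      | Aid y => if y is Aext h' then Aincx h' else tt
      | Ainc _ _ _ | Aincx _ => tt
      end
  end f.

Lemma Acomp1m (G : graph) (x y : Aob G) (f : Ahom x y) : Acomp (Aid y) f = f.
Proof. by case: f. Qed.

Lemma Aedge_ind (G : graph) (e : gedge G)
  (P : forall z, Ahom (Aedge e) z -> Prop) :
  P _ (Aid (Aedge e)) -> forall z f, P z f.
Proof.
move=> HP z f; move: P HP.
refine (match f as f in Ahom y z return
  (if y is Aedge e' as y return Ahom y z -> Prop then fun f =>
     forall P : (forall z, Ahom (Aedge e') z -> Prop), P _ (Aid _) -> P z f
   else fun=> True) f with Aid y => _ | _ => I end).
by case: y.
Qed.

Lemma Aext_ind (G : graph) (h : external G)
  (P : forall z, Ahom (Aext h) z -> Prop) :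
  P _ (Aid (Aext h)) -> forall z f, P z f.
Proof.
move=> HP z f; move: P HP.
refine (match f as f in Ahom y z return
  (if y is Aext h' as y return Ahom y z -> Prop then fun f =>
     forall P : (forall z, Ahom (Aext h') z -> Prop), P _ (Aid _) -> P z f
   else fun=> True) f with Aid y => _ | _ => I end).
by case: y.
Qed.

Lemma AcompA (G : graph) (x y z t : Aob G) (f : Ahom z t) (g : Ahom y z)
  (h : Ahom x y) : Acomp f (Acomp g h) = Acomp (Acomp f g) h.
Proof.
case: h f g => // [a e ae | a] f g; move: z g t f.
  by apply: Aedge_ind; apply: Aedge_ind.
by apply: Aext_ind; apply: Aext_ind.
Qed.

Definition Acat (G : graph) : category.
Proof.
exists (Aob G) (@Ahom G) (fun x y => @eq (Ahom x y)) (@Aid G) (@Acomp G).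
- by [].
- by [].
- by move=> x y f g h ->.
- by move=> x y z f f' g g' -> ->.
- by move=> x y z t f g h; rewrite AcompA.
- by move=> x y f; rewrite Acomp1m.
- by [].
Defined.

Definition Afun_map (G : graph) (C : category) (o : Aob G -> C)
    (inc : forall (h : halfedge G) (e : gedge G),
       h \in val e -> hom (o (Avert (gsrc h))) (o (Aedge e)))
    (incx : forall h : external G,
       hom (o (Avert (gsrc (val h)))) (o (Aext h)))
    (x y : Aob G) (f : Ahom x y) : hom (o x) (o y) :=
  match f in Ahom x y return hom (o x) (o y) with
  | Aid x => idm (o x)
  | Ainc h e he => inc h e he
  | Aincx h => incx h
  end.

(* A functor on [Acat G] is determined by arbitrary values on objects and on
   the non-identity morphisms. *)
Definition Afun (G : graph) (C : category) (o : Aob G -> C)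
    (inc : forall (h : halfedge G) (e : gedge G),
       h \in val e -> hom (o (Avert (gsrc h))) (o (Aedge e)))
    (incx : forall h : external G,
       hom (o (Avert (gsrc (val h)))) (o (Aext h))) : functor (Acat G) C.
Proof.
exists o (@Afun_map G C o inc incx).
- by move=> x y f g /= efg; rewrite efg; exact: heq_refl.
- by move=> x; exact: heq_refl.
- suff H (x y z : Aob G) (f : Ahom y z) (g : Ahom x y) :
      Afun_map inc incx (Acomp f g) =h
      Afun_map inc incx f ** Afun_map inc incx g by exact: H.
  move: z f; case: g => /= [w z f|h e he|h].
  + by apply: heq_sym; exact: mcompm1.
  + by apply: Aedge_ind => /=; apply: heq_sym; exact: mcomp1m.
  + by apply: Aext_ind => /=; apply: heq_sym; exact: mcomp1m.
Defined.

Lemma gedge_inv (G : graph) (e : gedge G) (h : halfedge G) :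
  h \in val e -> ginv h \in val e.
Proof.
case: e => E /= /existsP[k /andP[_ /eqP->]]; rewrite !inE.
by case/orP=> /eqP->; rewrite ?ginvK eqxx ?orbT.
Qed.

Definition AG_ob (G : graph) (x : Aob G) : Type :=
  match x with
  | Avert v => star G v
  | Aedge e => {h : halfedge G | h \in val e}
  | Aext _ => 'I_2
  end.

Definition AG (G : graph) : functor (Acat G) SET :=
  @Afun G SET (@AG_ob G)
    (fun h e he k => if val k == h then exist _ (ginv h) (gedge_inv he)
                     else exist _ h he)
    (fun h k => inord (if incoming (val h) then val k == val h
                       else val k != val h)).

(** * Structures on graphs *)

Record Lstruct (r : nat) (G : graph) := LStruct {
  Lfun :> functor (Acat G) (Lambda r);
  Lmu : nattrans (fcomp (lambda r) Lfun) (AG G);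
  Lmu_iso : nat_iso Lmu;
  (* with [Lmu_iso], this forces [Lfun (Aext h) = 1] and that the component of
     [Lmu] at [h] is the identity of ['I_2] *)
  Lmu_ext : forall (h : external G) i,
    (Lmu (Aext h) i : 'I_2) = i :> nat
}.

Definition Lmu_vert (r : nat) (G : graph) (A : Lstruct r G) (v : gvertex G) :
  'I_(Lfun A (Avert v)).+1 -> star G v := Lmu A (Avert v).

Definition Lstruct_iso (r : nat) (G : graph) (A B : Lstruct r G) : Prop :=
  exists theta : nattrans A B,
    [/\ nat_iso theta,
        forall x, Lmu B x ** fmap (lambda r) (theta x) =h Lmu A x
      & forall h : external G, is_identity (theta (Aext h))].

Arguments Lmu_vert {r G} A v i.

(* [cyc h] is the successor of [h] in the cyclic order on [star G (gsrc h)];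
   [ordS] is the successor in the standard cyclic order. *)
Definition Lstruct_cyclic (r : nat) (G : graph)
    (cyc : halfedge G -> halfedge G) (A : Lstruct r G) : Prop :=
  forall v i, val (Lmu_vert A v (ordS i)) = cyc (val (Lmu_vert A v i)).

(** * Surfaces with PLCW decompositions *)

Variant bkind := Free | Ingoing | Outgoing.

(* An oriented edge [(e, b)] is the edge [e] with its reference direction
   ([b = true]) or the opposite one. *)
Definition rev (K1 : finType) (d : K1 * bool) := (d.1, ~~ d.2).

Definition outside (K2 : finType) (x : K2 + bkind) : bool :=
  if x is inr _ then true else false.

Definition is_free (K2 : finType) (x : K2 + bkind) : bool :=
  if x is inr Free then true else false.

Definition is_face (K2 : finType) (f : K2) (x : K2 + bkind) : bool :=
  if x is inl g then g == f else false.

(* The combinatorial data of a PLCW decomposition [K] of a compact oriented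
   punctured surface with free and parametrized boundary.  A side of a face is
   the same thing as an oriented edge [d] having the face on its left, i.e. a
   side directed counterclockwise along the boundary of the face; then
   [left d = inl f].  If instead [d] has no face on its left, it runs along the
   boundary with the surface on its right; then [left d = inr k], where [k]
   is the kind of that boundary edge.  On sides of faces, [ccw] is the
   counterclockwise next side of the same face; on the remaining oriented edges
   its orbits are the boundary circles.  [ccw (rev d)] is the clockwise next
   oriented edge after [d] around the origin of [d]. *)
Record surface := Surface {
  K0 : finType;
  K1 : finType;
  K2 : finType;
  left : K1 * bool -> K2 + bkind;
  ccw : K1 * bool -> K1 * bool;
  org : K1 * bool -> K0;
  puncture : {set K0};
  ccw_inj : injective ccw;
  left_ccw : forall d f, left (ccw d) = inl f <-> left d = inl f;
  face_cycle : forall d d' f,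
    left d = inl f -> left d' = inl f -> fconnect ccw d d';
  face_side : forall f, exists d, left d = inl f;
  edge_face : forall d, outside (left d) -> ~~ outside (left (rev d));
  org_ccw : forall d, org (ccw d) = org (rev d);
  org_surj : forall v, exists d, org d = v;
  (* The link of a vertex is connected: a circle, or one interval. *)
  org_link : forall d d', org d = org d' -> fconnect (ccw \o @rev K1) d d';
  org_outside : forall d d',
    outside (left d) -> outside (left d') -> org d = org d' -> d = d';
  puncture_interior : forall d, outside (left d) -> org d \notin puncture
}.

Arguments left {s} d : rename.
Arguments ccw {s} d : rename.
Arguments org {s} d : rename.

Notation oedge K := (K1 K * bool)%type.

Definition boundary_vertex (K : surface) (v : K0 K) : bool :=
  [exists d : oedge K, outside (left d) && (org d == v)].

Definition free_edge (K : surface) (e : K1 K) : bool :=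
  is_free (left (e, true)) || is_free (left (e, false)).

(* No boundary circle is entirely free. *)
Definition whole (K : surface) : Prop :=
  forall d : oedge K, outside (left d) ->
    exists2 d', fconnect ccw d d' & ~~ is_free (left d').

(* No boundary circle is entirely parametrized. *)
Definition open_parametrization (K : surface) : Prop :=
  forall d : oedge K, outside (left d) ->
    exists2 d', fconnect ccw d d' & is_free (left d').

(* Consecutive parametrized edges only occur on parametrized circles (of a
   single kind): parametrized intervals consist of one edge and alternate with
   free intervals. *)
Definition admissible (K : surface) : Prop :=
  forall d : oedge K, outside (left d) ->
    ~~ is_free (left d) -> ~~ is_free (left (ccw d)) ->
    forall d', fconnect ccw d d' -> left d' = left d.

(** * Markings *)

(* [Z/r] for [r > 0], including [r = 1] *)
Notation Zmod r := 'I_r.-1.+1 (only parsing).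

Notation Kbar1 K := {e : K1 K | ~~ free_edge e}.

(* The oriented edge [(e, ori e)] is [e] with its orientation.  When all interior
   vertices are punctures and there are no closed parametrized components, there
   is no admissibility condition on markings. *)
Record marking (r : nat) (K : surface) := Marking {
  ori : {ffun Kbar1 K -> bool};
  lab : {ffun Kbar1 K -> Zmod r};
  mark : {ffun K2 K -> oedge K};
  left_mark : forall f, left (mark f) = inl f
}.

Local Open Scope ring_scope.

Definition rev_edge (r : nat) (K : surface) (e : Kbar1 K) (m : marking r K) :
  marking r K :=
  Marking [ffun e' => (e' == e) (+) ori m e']
          [ffun e' => if e' == e then - lab m e' - inZp 1 else lab m e']
          (left_mark m).

Lemma left_ccw_mark (r : nat) (K : surface) (f : K2 K) (m : marking r K) f' :
  left ([ffun f' => if f' == f then ccw (mark m f') else mark m f'] f') =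
  inl f'.
Proof.
by rewrite ffunE; case: ifP => _; [apply/left_ccw|]; apply: left_mark.
Qed.

(* The marked side [mark m f] has [f] on the left of its underlying edge iff its
   counterclockwise direction is the orientation of that edge. *)
Definition move_mark (r : nat) (K : surface) (f : K2 K) (m : marking r K) :
  marking r K :=
  Marking (ori m)
          [ffun e => if val e == (mark m f).1 then
                       if (mark m f).2 == ori m e then lab m e - inZp 1
                       else lab m e + inZp 1
                     else lab m e]
          (left_ccw_mark f m).

Definition deck (r : nat) (K : surface) (f : K2 K) (k : Zmod r)
    (m : marking r K) : marking r K :=
  Marking (ori m)
          [ffun e => lab m e
             + (if is_face f (left (val e, ori m e)) then k else 0)
             - (if is_face f (left (val e, ~~ ori m e)) then k else 0)]
          (left_mark m).

Variant fixed_move (r : nat) (K : surface) (m : marking r K) :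
  marking r K -> Prop :=
| FixRev e : fixed_move m (rev_edge e m)
| FixMark f : fixed_move m (move_mark f m)
| FixDeck f k : fixed_move m (deck f k m).

Definition sim_fix (r : nat) (K : surface) : relation (marking r K) :=
  clos_refl_sym_trans _ (@fixed_move r K).

Local Close Scope ring_scope.

(** * The dual graph *)

Definition is_side (K : surface) (d : oedge K) : bool :=
  ~~ outside (left d) && ~~ free_edge d.1.

Notation side K := {d : oedge K | is_side d}.

Definition left_face (K : surface) (d : oedge K) :
    ~~ outside (left d) -> K2 K :=
  match left d as x return ~~ outside x -> K2 K with
  | inl f => fun=> f
  | inr _ => fun not_out => False_rect _ (notF not_out)
  end.

Definition side_face (K : surface) (h : side K) : K2 K :=
  left_face (proj1 (andP (valP h))).

Definition side_inv (K : surface) (h : side K) : side K :=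
  insubd h (rev (val h)).

Lemma side_faceP (K : surface) (h : side K) :
  left (val h) = inl (side_face h).
Proof.
rewrite /side_face; move: (proj1 _); rewrite /left_face.
by case: (left _) => //= x; case: (notF x).
Qed.

Lemma revK (K1 : finType) : involutive (@rev K1).
Proof. by case=> e b; rewrite /rev /= negbK. Qed.

Lemma side_inv_val (K : surface) (h : side K) :
  val (side_inv h) = if is_side (rev (val h)) then rev (val h) else val h.
Proof. by rewrite /side_inv val_insubd. Qed.

Lemma side_invK (K : surface) : involutive (@side_inv K).
Proof.
move=> h; apply: val_inj; rewrite side_inv_val.
have := side_inv_val h; case e: (is_side (rev (val h))) => ->.
  by rewrite revK (valP h).
by rewrite e.
Qed.

Lemma left_orbit (K : surface) (d d' : oedge K) f :
  fconnect ccw d d' -> (left d' = inl f <-> left d = inl f).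
Proof.
case/iter_findex => <-; elim: (findex _ _ _) => //= k IHk.
by split=> [/left_ccw/IHk|/IHk/left_ccw].
Qed.

Lemma side_face_surj (K : surface) : whole K ->
  forall f : K2 K, exists h : side K, side_face h = f.
Proof.
move=> wK f; have [d df] := face_side f.
have [/existsP[d' /andP[dd' sd']]|] :=
    boolP [exists d', fconnect ccw d d' && is_side d'].
  pose h : side K := exist _ d' sd'; exists h.
  have : left (val h) = inl f by apply/(left_orbit f dd').
  by rewrite side_faceP => -[].
move/existsPn=> noside; exfalso.
have free_rev d' : fconnect ccw d d' -> is_free (left (rev d')).
  move=> dd'; have ld' := proj2 (left_orbit f dd') df.
  move: (noside d'); rewrite dd' /= /is_side ld' /= negbK /free_edge.
  case: {dd'} d' ld' => e [] ld'; rewrite ld' /= ?orbF //.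
pose out := rev d.
have outP x : fconnect ccw d x -> outside (left (rev x)).
  by move/free_rev; case: (left _) => [|[]].
have step x : fconnect ccw d x -> ccw (rev (ccw x)) = rev x.
  move=> dx; have dx' : fconnect ccw d (ccw x).
    exact: connect_trans dx (fconnect1 _ _).
  apply: org_outside.
  - case e: (left _) => [g|//]; move/left_ccw: e (outP _ dx') => ->.
    by [].
  - exact: outP.
  by rewrite org_ccw revK org_ccw.
have [d' od' nfree] := wK _ (outP d (connect0 _ _)).
have [x dx ed'] : exists2 x, fconnect ccw d x & d' = rev x.
  case/iter_findex: od' => <-; elim: (findex _ _ _) => [|k [x dx ex]] /=.
    by exists d.
  rewrite ex; exists (finv ccw x).
    exact: connect_trans dx (fconnect_finv _ _).
  rewrite -{1}(f_finv (@ccw_inj K) x) step //.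
  exact: connect_trans dx (fconnect_finv _ _).
by rewrite ed' free_rev in nfree.
Qed.

Definition ingoing_side (K : surface) (h : side K) : bool :=
  if left (rev (val h)) is inr Ingoing then true else false.

Definition dual_graph (K : surface) (wK : whole K) : graph :=
  Graph (@side_invK K) (side_face_surj wK) (@ingoing_side K).

(* The sides of a face which are not in the free boundary, listed
   counterclockwise from [d]. *)
Definition sides_from (K : surface) (d : oedge K) : seq (side K) :=
  pmap insub (orbit ccw d).

(* counterclockwise successor among the half-edges at a vertex *)
Definition dual_cyc (K : surface) (h : side K) : side K :=
  next (sides_from (val h)) h.

(** * The induced structure *)

Definition side_edge (K : surface) (h : side K) : Kbar1 K :=
  exist _ (val h).1 (proj2 (andP (valP h))).

Definition misoriented (r : nat) (K : surface) (m : marking r K)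
    (e : Kbar1 K) : bool :=
  match left (val e, ori m e), left (val e, ~~ ori m e) with
  | _, inr Ingoing => true
  | inr Outgoing, _ => true
  | _, _ => false
  end.

(* [m] with ingoing (outgoing) boundary edges oriented so that the surface is on
   their right (left) *)
Definition normalize (r : nat) (K : surface) (m : marking r K) : marking r K :=
  Marking [ffun e => misoriented m e (+) ori m e]
          [ffun e => if misoriented m e then (- lab m e - inZp 1)%R
                     else lab m e]
          (left_mark m).

(* the face of [h] lies on the left of the underlying edge *)
Definition on_left (r : nat) (K : surface) (m : marking r K) (h : side K) :=
  (val h).2 == ori m (side_edge h).

Definition psi_last (n k : nat) : word n 1 :=
  wcomp (wdelta (phi_last n)) (tauZ n (k%:Z - n%:Z)%R).

Definition psi_first (n k : nat) : word n 1 :=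
  wcomp (wdelta (phi_first n)) (tauZ n k%:Z).

Definition face_sides (r : nat) (K : surface) (m : marking r K) (f : K2 K) :=
  sides_from (mark m f).

Definition induced_ob (r : nat) (K : surface) (wK : whole K)
    (m : marking r K) (x : Aob (dual_graph wK)) : Lambda r :=
  if x is Avert f then (size (face_sides m f)).-1 else 1.

(* [tau_n] has order dividing [r (n + 1)], so below labels in [Z/r] may be
   replaced by their representatives in [0, r - 1]. *)
Definition induced_inner (r : nat) (K : surface) (m : marking r K)
    (h : side K) : word (size (face_sides m (side_face h))).-1 1 :=
  let n := (size (face_sides m (side_face h))).-1 in
  let k := index h (face_sides m (side_face h)) in
  let s : nat := lab (normalize m) (side_edge h) in
  if on_left (normalize m) h then psi_first n k
  else wcomp (psi_last n k) (tauZ n (- (n.+1 * s)%N%:Z)%R).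

Definition induced_outer (r : nat) (K : surface) (m : marking r K)
    (h : side K) : word (size (face_sides m (side_face h))).-1 1 :=
  let n := (size (face_sides m (side_face h))).-1 in
  let k := index h (face_sides m (side_face h)) in
  let s : nat := lab (normalize m) (side_edge h) in
  if ingoing_side h then
    wcomp (psi_last n k) (tauZ n (- (n.+1 * s)%N%:Z)%R)
  else wcomp (psi_first n k) (tauZ n (n.+1 * s.+1)%N%:Z).

Definition induced_fun (r : nat) (K : surface) (wK : whole K)
    (m : marking r K) : functor (Acat (dual_graph wK)) (Lambda r) :=
  @Afun (dual_graph wK) (Lambda r) (@induced_ob r K wK m)
    (fun h _ _ => induced_inner m h) (fun h => induced_outer m (val h)).

Lemma mem_face_sides (r : nat) (K : surface) (m : marking r K) (f : K2 K)
  (h : side K) : (h \in face_sides m f) = (side_face h == f).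
Proof.
rewrite /face_sides /sides_from mem_pmap_sub -fconnect_orbit.
apply/idP/eqP => [/(left_orbit f) e|<-].
  by move/e: (left_mark m f); rewrite side_faceP => -[].
by apply: (@face_cycle K _ _ (side_face h)); [apply: left_mark|apply: side_faceP].
Qed.

Lemma size_face_sides (r : nat) (K : surface) (wK : whole K)
  (m : marking r K) (f : K2 K) :
  (size (face_sides m f)).-1.+1 = size (face_sides m f).
Proof.
have [h hf] := side_face_surj wK f.
have : h \in face_sides m f by rewrite mem_face_sides hf.
by case: (face_sides m f).
Qed.

Lemma uniq_face_sides (r : nat) (K : surface) (m : marking r K) (f : K2 K) :
  uniq (face_sides m f).
Proof. exact/pmap_sub_uniq/orbit_uniq. Qed.

Lemma nth_face_sides (r : nat) (K : surface) (wK : whole K)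
  (m : marking r K) (f : K2 K) (i : 'I_(size (face_sides m f)).-1.+1) :
  side_face (tnth (in_tuple (face_sides m f))
               (cast_ord (size_face_sides wK m f) i)) == f.
Proof. by rewrite -(mem_face_sides m) mem_tnth. Qed.

Lemma dual_edge_side (r : nat) (K : surface) (wK : whole K) (m : marking r K)
  (e : gedge (dual_graph wK)) (b : bool) :
  exists h, (h \in val e) && (on_left m h == b).
Proof.
case: e => E /= /existsP[h /andP[nh /eqP->]].
have [<-|nb] := eqVneq (on_left m h) b; first by exists h; rewrite !inE !eqxx.
exists (side_inv h); rewrite !inE eqxx orbT /=.
move: nh; rewrite -val_eqE /= side_inv_val; case: ifP => [sr _|]; last first.
  by rewrite eqxx.
move: nb; rewrite /on_left; have -> : side_edge (side_inv h) = side_edge h.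
  by apply: val_inj; rewrite /= side_inv_val sr.
by rewrite side_inv_val sr /=; case: (val h).2 (ori _ _) b => [] [] [].
Qed.

Definition induced_mu (r : nat) (K : surface) (wK : whole K)
    (m : marking r K) (x : Aob (dual_graph wK)) :
    'I_(induced_ob m x).+1 -> AG_ob x :=
  match x return 'I_(induced_ob m x).+1 -> AG_ob x with
  | Avert f => fun i => exist _ (tnth _ _) (nth_face_sides wK i)
  | Aedge e => fun i =>
      let ex := dual_edge_side (normalize m) e (i == 1 :> nat) in
      exist _ (xchoose ex) (proj1 (andP (xchooseP ex)))
  | Aext _ => id
  end.

Lemma tauZ_funE n (z : int) (i : 'I_n.+1) :
  (word_fun (tauZ n z) i : int) = modz ((i : int) - z) n.+1.
Proof.
case: z => k /=.
  rewrite tauX_funE -modz_nat PoszD PoszM.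
  have -> : (i%:Z + k%:Z * n%:Z = k%:Z * n.+1%:Z + (i%:Z - k%:Z))%R by lia.
  by rewrite modzMDl.
have -> : word_fun (tauVX n k) i = inord ((i + k) %% n.+1).
  elim: k => [|k IHk] /=; first by rewrite addn0 modn_small // inord_val.
  rewrite IHk; apply: ord_inj; rewrite /= !inordK ?ltn_pmod //.
  by rewrite -addn1 modnDml addn1 addnS.
rewrite /= inordK ?ltn_pmod // -addn1 modnDml -modz_nat NegzE.
by congr modz; lia.
Qed.

Lemma tauZ_mulK n (z : int) (i : 'I_n.+1) :
  word_fun (tauZ n (n.+1%:Z * z)%R) i = i.
Proof.
apply: ord_inj; have := tauZ_funE (n.+1%:Z * z)%R i.
have -> : (i%:Z - n.+1%:Z * z = - z * n.+1%:Z + i%:Z)%R by lia.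
by rewrite modzMDl modz_nat modn_small // => -[].
Qed.

Lemma psi_last_fun n k (i : 'I_n.+1) : k <= n ->
  word_fun (psi_last n k) i = inord (i == k :> nat) :> 'I_2.
Proof.
move=> lekn; rewrite /psi_last /=; congr inord; congr nat_of_bool.
set j := word_fun _ i; have jE := tauZ_funE (k%:Z - n%:Z)%R i.
rewrite -/j in jE; have [ltij|leji] := ltnP k i.
  have : modz (i%:Z - (k%:Z - n%:Z))%R n.+1 = (i - k.+1)%N.
    have -> : (i%:Z - (k%:Z - n%:Z) = 1 * n.+1%:Z + (i - k.+1)%N%:Z)%R by lia.
    rewrite modzMDl modz_nat modn_small //; have := ltn_ord i; lia.
  by rewrite -jE => -[->]; have := ltn_ord i; lia.
have : modz (i%:Z - (k%:Z - n%:Z))%R n.+1 = (i + (n - k))%N.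
  have -> : (i%:Z - (k%:Z - n%:Z) = (i + (n - k))%N%:Z)%R by lia.
  by rewrite modz_nat modn_small; lia.
by rewrite -jE => -[->]; lia.
Qed.

Lemma psi_first_fun n k (i : 'I_n.+1) : k <= n ->
  word_fun (psi_first n k) i = inord (i != k :> nat) :> 'I_2.
Proof.
move=> lekn; rewrite /psi_first /=; congr inord; congr nat_of_bool.
set j := word_fun _ i; have jE := tauZ_funE k%:Z i.
rewrite -/j in jE.
have [leki|ltik] := leqP k i.
  have : modz (i%:Z - k%:Z)%R n.+1 = (i - k)%N.
    have -> : (i%:Z - k%:Z = (i - k)%N%:Z)%R by lia.
    by rewrite modz_nat modn_small //; have := ltn_ord i; lia.
  by rewrite -jE => -[->]; lia.
have : modz (i%:Z - k%:Z)%R n.+1 = (i + n.+1 - k)%N.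
  have -> : (i%:Z - k%:Z = (-1) * n.+1%:Z + (i + n.+1 - k)%N%:Z)%R by lia.
  by rewrite modzMDl modz_nat modn_small //; lia.
by rewrite -jE => -[->]; lia.
Qed.

Lemma index_face_sides (r : nat) (K : surface) (wK : whole K)
  (m : marking r K) (h : side K) :
  index h (face_sides m (side_face h)) <=
  (size (face_sides m (side_face h))).-1.
Proof. by rewrite -ltnS (size_face_sides wK) index_mem mem_face_sides. Qed.

Lemma word_fun_comp n m p (f : word m p) (g : word n m) i :
  word_fun (wcomp f g) i = word_fun f (word_fun g i).
Proof. by []. Qed.

Lemma induced_inner_fun (r : nat) (K : surface) (wK : whole K)
  (m : marking r K) (h : side K) i :
  word_fun (induced_inner m h) i =
  inord ((i == index h (face_sides m (side_face h)) :> nat)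
         (+) on_left (normalize m) h) :> 'I_2.
Proof.
have lei := index_face_sides wK m h.
rewrite /induced_inner; case: ifP => _; first by rewrite psi_first_fun // addbT.
by rewrite word_fun_comp PoszM -mulrN tauZ_mulK psi_last_fun // addbF.
Qed.

Lemma induced_outer_fun (r : nat) (K : surface) (wK : whole K)
  (m : marking r K) (h : side K) i :
  word_fun (induced_outer m h) i =
  inord ((i == index h (face_sides m (side_face h)) :> nat)
         (+) ~~ ingoing_side h) :> 'I_2.
Proof.
have lei := index_face_sides wK m h.
rewrite /induced_outer; case: ifP => _; rewrite word_fun_comp PoszM.
  by rewrite -mulrN tauZ_mulK psi_last_fun // addbF.
by rewrite tauZ_mulK psi_first_fun // addbT.
Qed.

Lemma tnth_face_sides (r : nat) (K : surface) (wK : whole K)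
  (m : marking r K) (f : K2 K) (i : 'I_(size (face_sides m f)).-1.+1)
  (h : side K) : side_face h = f ->
  (tnth (in_tuple (face_sides m f)) (cast_ord (size_face_sides wK m f) i) == h)
  = (i == index h (face_sides m f) :> nat).
Proof.
move=> hf; rewrite (tnth_nth h) /=.
have hin : h \in face_sides m f by rewrite mem_face_sides hf.
have lti : i < size (face_sides m f).
  by have := ltn_ord i; rewrite [X in _ < X](size_face_sides wK).
apply/eqP/eqP => [<-|->]; last exact: nth_index.
by rewrite index_uniq // uniq_face_sides.
Qed.

Lemma gedge_mem (K : surface) (wK : whole K) (e : gedge (dual_graph wK))
  (h h' : side K) : h \in val e -> h' \in val e ->
  is_side (rev (val h)) /\ (h' = h \/ h' = side_inv h).
Proof.
case: e => E /= /existsP[k /andP[nk /eqP->]].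
have sk : is_side (rev (val k)).
  by move: nk; rewrite -val_eqE /= side_inv_val; case: ifP => //; rewrite eqxx.
rewrite !inE => /orP[]/eqP-> /orP[]/eqP->; rewrite ?side_invK;
  split; auto; by rewrite side_inv_val sk revK (valP k).
Qed.

Lemma on_left_inv (r : nat) (K : surface) (m : marking r K) (h : side K) :
  is_side (rev (val h)) -> on_left m (side_inv h) = ~~ on_left m h.
Proof.
move=> sr; rewrite /on_left.
have -> : side_edge (side_inv h) = side_edge h.
  by apply: val_inj; rewrite /= side_inv_val sr.
by rewrite side_inv_val sr /=; case: (val h).2 (ori _ _) => [] [].
Qed.

Lemma on_left_gedge (r : nat) (K : surface) (wK : whole K) (m : marking r K)
  (e : gedge (dual_graph wK)) (h h' : side K) : h \in val e -> h' \in val e ->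
  (on_left m h == on_left m h') = (h == h').
Proof.
move=> he he'; have [sr [->|e']] := gedge_mem he he'; first by rewrite !eqxx.
rewrite e' on_left_inv //; apply/idP/eqP; first by case: (on_left m h).
move/(congr1 (on_left m)); rewrite on_left_inv //.
by case: (on_left m h).
Qed.

Lemma induced_mu_edgeP (r : nat) (K : surface) (wK : whole K)
  (m : marking r K) (e : gedge (dual_graph wK)) (i : 'I_2) :
  let h := val (@induced_mu r K wK m (Aedge e) i) in
  h \in val e /\ on_left (normalize m) h = (i == 1 :> nat).
Proof. by have /andP[? /eqP] := xchooseP (dual_edge_side (normalize m) e (i == 1 :> nat)). Qed.

Definition induced_nat (r : nat) (K : surface) (wK : whole K)
  (m : marking r K) :
  nattrans (fcomp (lambda r) (induced_fun wK m)) (AG (dual_graph wK)).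
Proof.
exists (@induced_mu r K wK m) => x y [z i|h e he i|h i] //=.
- apply: val_inj; rewrite /= induced_inner_fun //.
  rewrite (fun_if val) /=.
  have [] := induced_mu_edgeP m e
    (word_fun (induced_inner m h) i); rewrite /= induced_inner_fun //.
  set h' := xchoose _; rewrite -/h' (tnth_face_sides wK) // => he'.
  rewrite inordK ?ltnS ?leq_b1 // eqb1 => ol.
  have [eik|nik] := eqVneq (i : nat) _; rewrite ?eik ?eqxx ?(negbTE nik) in ol *.
    apply/eqP; rewrite -(on_left_gedge (normalize m) he' (gedge_inv he)).
    by rewrite /= on_left_inv ?ol //; case: (gedge_mem he he).
  by apply/eqP; rewrite -(on_left_gedge (normalize m) he' he) ol.
- rewrite induced_outer_fun // (tnth_face_sides wK) //.
  by case: ifP => _; rewrite ?addbF ?addbT.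
Defined.

Lemma ltn_index_pred (T : eqType) (s : seq T) (x : T) :
  x \in s -> index x s < (size s).-1.+1.
Proof. by rewrite -index_mem; case: s. Qed.

Lemma induced_nat_iso (r : nat) (K : surface) (wK : whole K)
  (m : marking r K) : nat_iso (induced_nat wK m).
Proof.
case=> [f|e|h].
- exists (fun h : AG_ob (Avert f) => inord (index (val h) (face_sides m f))).
  split=> [i|h] /=.
    apply: ord_inj; rewrite inordK; last by rewrite ltn_index_pred ?mem_tnth.
    apply/eqP; rewrite eq_sym -(tnth_face_sides wK) //.
    exact/eqP/nth_face_sides.
  apply: val_inj => /=; apply/eqP; have hf : side_face (val h) = f := eqP (valP h).
  rewrite (tnth_face_sides wK) // inordK //.
  by rewrite ltn_index_pred // mem_face_sides hf.
- exists (fun h : AG_ob (Aedge e) =>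
            inord (on_left (normalize m) (val h)) : 'I_2).
  split=> [i|h].
    have [_ ol] := induced_mu_edgeP m e i.
    apply: ord_inj; rewrite /= in ol *; rewrite ol inordK ?ltnS ?leq_b1 //.
    by case: i {ol} => [[|[]]].
  apply: val_inj; apply/eqP.
  have [he' ol] := induced_mu_edgeP m e (inord (on_left (normalize m) (val h))).
  rewrite -(on_left_gedge (normalize m) he' (valP h)) ol.
  by rewrite inordK ?ltnS ?leq_b1 // eqb1.
- by exists id.
Qed.

Definition induced (r : nat) (K : surface) (wK : whole K) (m : marking r K) :
  Lstruct r (dual_graph wK) :=
  @LStruct r (dual_graph wK) (induced_fun wK m) (induced_nat wK m)
    (@induced_nat_iso r K wK m) (fun _ _ => erefl).

Lemma nth_succ (T : Type) (h : T) (s : seq T) k : k < size s ->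
  nth h s (k.+1 %% (size s).-1.+1) = if s is y :: s' then nth y s' k else h.
Proof.
case: s => //= y s; rewrite ltnS leq_eqVlt => /predU1P[->|lt].
  by rewrite modnn /= nth_default.
by rewrite modn_small //=; apply: set_nth_default.
Qed.

Lemma induced_cyclic (r : nat) (K : surface) (wK : whole K)
  (m : marking r K) : Lstruct_cyclic (G := dual_graph wK) (@dual_cyc K) (induced wK m).
Proof.
move=> f i; rewrite /=; set S := in_tuple _; set c := cast_ord _.
set h := tnth S (c i).
have hf : side_face h = f by apply/eqP/nth_face_sides.
have hS : h \in face_sides m f by rewrite mem_tnth.
have US := uniq_face_sides m f.
have cyc_orb d : fcycle ccw (orbit (@ccw K) d) := cycle_orbit (@ccw_inj K) d.
have [j oE] : {j | sides_from (val h) = rot j (face_sides m f)}.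
  rewrite /sides_from /face_sides /sides_from.
  have ho : val h \in orbit ccw (mark m f).
    by rewrite -mem_pmap_sub.
  have [j ->] := orbit_rot_cycle (cyc_orb (mark m f)) (orbit_uniq _ _) ho.
  set o := orbit ccw _; pose p : seq (side K) := pmap insub (take j o).
  exists (size p); rewrite -[X in _ = rot _ (pmap _ X)](cat_take_drop j o) /rot.
  by rewrite !pmap_cat -/p drop_size_cat ?take_size_cat.
rewrite /dual_cyc oE next_rot // next_nth hS.
have hidx : index h (face_sides m f) = i.
  by apply/eqP; rewrite eq_sym -(tnth_face_sides wK).
rewrite hidx (tnth_nth h) /=.
have lti : i < size (face_sides m f).
  by have := ltn_ord i; rewrite [X in _ < X](size_face_sides wK).
exact: nth_succ.
Qed.

(** * Quotients *)

(* the set of classes [R x] of an equivalence relation [R] *)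
Definition quot (T : Type) (R : T -> T -> Prop) : Type :=
  {C : T -> Prop | exists x, C = R x}.

Definition class (T : Type) (R : T -> T -> Prop) (x : T) : quot R :=
  exist _ (R x) (ex_intro _ x erefl).

(* the structures inducing the cyclic orders given by the surface *)
Definition LstructS (r : nat) (K : surface) (wK : whole K) : Type :=
  {A : Lstruct r (dual_graph wK) |
    Lstruct_cyclic (G := dual_graph wK) (@dual_cyc K) A}.

Definition sim_iso (r : nat) (K : surface) (wK : whole K)
  (A B : LstructS r wK) : Prop := Lstruct_iso (sval A) (sval B).

Definition inducedS (r : nat) (K : surface) (wK : whole K) (m : marking r K) :
  LstructS r wK := exist _ (induced wK m) (@induced_cyclic r K wK m).

(* Main.v *)
(* A morphism [n] -> [m] of the r-cyclic category is the same thing as a monotone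
   map F of the integers with F (x + n + 1) = F x + m + 1, up to adding multiples
   of r (m + 1); completeness of the relations follows from the normal form
   delta tau^k.  In a structure on a graph, the map F attached to a half-edge h
   with position p among the half-edges at its vertex jumps by one at p and after
   p, and is determined by the integer F p.  Hence an isomorphism between two
   structures amounts to one translation for each vertex and each edge.
   Eliminating the edge translations, what remains for each edge is the difference
   of the two integers at its half-edges modulo 2r, which is 1 + 2s for an induced
   structure, where s is the label of the edge.  The vertex translations act on
   these labels exactly like mark moves and deck transformations.  Since the
   difference is always odd, each structure is induced by a marking. *)
From Stdlib Require Import Relations FunctionalExtensionality.
From Stdlib Require Import PropExtensionality ProofIrrelevance.
Require Import Defs.
From mathcomp Require Import all_boot all_algebra.
From mathcomp Require Import zify.

Set Implicit Arguments.
Unset Strict Implicit.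
Unset Printing Implicit Defensive.

Import GRing.Theory.

(** * Lifting the r-cyclic category to periodic maps of the integers *)

(** The integer model is faithful because the periodic lift of a simplicial map is nonnegative
    exactly on the nonnegative integers: the power of [tau] in a normal form is the place where the
    map changes sign.

    A translation [t] at a vertex carries some half-edges past the seam between the last and the
    first position. The signed number [q h] of passages changes the value at [h] by [2 * q h]. A
    step of a mark takes at most one side past the seam, a deck transformation takes all sides of
    the face past it equally often. The relation [turned] records [t] and [q] for markings and
    mediates between the two equivalences. The modulus [2r] is [r * (m + 1)] for [m = 1], since
    edges go to [1].

    An external half-edge admits no free translation, as isomorphisms are the identity there. Its
    value itself, not a difference, therefore determines the label modulo [r], and its parity is
    forced by the direction of the boundary edge.

    Labels are compared as seen from a side ([slab]), that is, with the face on the left. The two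
    sides of an edge see [s] and [-1 - s], so no formula depends on the chosen orientations. *)

Definition dmap_lift n m (f : dmap n m) (x : int) : int :=
  ((f (inord `|(x %% n.+1)%Z|%N))%:Z + (x %/ n.+1)%Z * m.+1%:Z)%R.

Fixpoint wev n m (w : word n m) : int -> int :=
  match w with
  | wid _ => id
  | wcomp _ _ _ f g => wev f \o wev g
  | wdelta _ _ f => dmap_lift f
  | wtau _ => fun x => (x - 1)%R
  | wtauV _ => fun x => (x + 1)%R
  end.

Lemma int_split n (x : int) :
  exists (i : 'I_n.+1) (q : int), x = (i%:Z + q * n.+1%:Z)%R.
Proof.
have lt : `|(x %% n.+1)%Z|%N < n.+1 by have := @ltz_pmod x n.+1; lia.
exists (Ordinal lt), (x %/ n.+1)%Z; rewrite /= {1}(divz_eq x n.+1).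
by have := @modz_ge0 x n.+1; lia.
Qed.

Lemma dmap_liftE n m (f : dmap n m) (i : 'I_n.+1) (q : int) :
  dmap_lift f (i%:Z + q * n.+1%:Z)%R = ((f i)%:Z + q * m.+1%:Z)%R.
Proof.
rewrite /dmap_lift (addrC (Posz i)) modzMDl divzMDl // divz_small ?addr0; last first.
  by have := ltn_ord i; lia.
by rewrite modz_small ?inord_val //; have := ltn_ord i; lia.
Qed.

Lemma dmap_liftE0 n m (f : dmap n m) (i : 'I_n.+1) :
  dmap_lift f i = Posz (f i).
Proof.
by rewrite -[in LHS](addr0 (Posz i)) -(mul0r (Posz n.+1)) dmap_liftE mul0r addr0.
Qed.

Lemma wev_period n m (w : word n m) (x q : int) :
  wev w (x + q * n.+1%:Z)%R = (wev w x + q * m.+1%:Z)%R.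
Proof.
elim: w x q => {n m} //= [n m p f IHf g IHg|n m f|n|n] x q.
- by rewrite IHg IHf.
- have [i [k ->]] := int_split n x.
  by rewrite -addrA -mulrDl !dmap_liftE mulrDl addrA.
- by rewrite addrAC.
- by rewrite addrAC.
Qed.

Lemma wev_mono n m (w : word n m) (x y : int) :
  (x <= y)%R -> (wev w x <= wev w y)%R.
Proof.
elim: w x y => {n m} //= [n m p f IHf g IHg|n m f|n|n] x y lexy.
- exact/IHf/IHg.
- have [i [k ex]] := int_split n x; have [j [l ey]] := int_split n y.
  rewrite ex ey !dmap_liftE; have := ltn_ord i; have := ltn_ord j.
  have := ltn_ord (f i); have := ltn_ord (f j) => fj fi lj li.
  have [kl|kl] : k = l \/ (k + 1 <= l)%R.
    have [|] := boolP (k + 1 <= l)%R; first by right.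
    have [|] := boolP (k <= l)%R; first by left; lia.
    by nia.
  - by have := @dmono _ _ f i j; nia.
  - by nia.
- lia.
- lia.
Qed.

Lemma wev_word_fun n m (w : word n m) (i : 'I_n.+1) :
  exists q : int, wev w i = ((word_fun w i)%:Z + q * m.+1%:Z)%R.
Proof.
elim: w i => {n m} //= [n|n m p f IHf g IHg|n m f|n|n] i.
- by exists 0%R; rewrite mul0r addr0.
- have [q ->] := IHg i; have [q' e] := IHf (word_fun g i).
  by exists (q' + q)%R; rewrite wev_period e mulrDl addrA.
- by exists 0%R; rewrite dmap_liftE0 mul0r addr0.
- case: i => [[|i] lti] /=.
    by exists (-1)%R; rewrite modn_small //; lia.
  by exists 0%R; rewrite modnDr modn_small; lia.
- case: i => [i lti] /=.
  have [e|ne] := eqVneq i n.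
    by exists 1%R; rewrite e modnn; lia.
  by exists 0%R; rewrite modn_small; lia.
Qed.

Lemma wev_tauX n k x : wev (tauX n k) x = (x - k%:Z)%R.
Proof. by elim: k => [|k IHk] /=; rewrite ?IHk; lia. Qed.

Lemma wev_tauZ n (z x : int) : wev (tauZ n z) x = (x - z)%R.
Proof.
case: z => k; first exact: wev_tauX.
rewrite NegzE /=; have -> : wev (tauVX n k) x = (x + k%:Z)%R.
  by elim: k => [|k /= ->] /=; lia.
by lia.
Qed.

(** The ambiguity is by full multiples of [r] turns of the target, which is what the relation on the
    order of [tau] identifies. *)
Definition wev_eq r n m (f g : word n m) : Prop :=
  exists j : int, forall x, wev f x = (wev g x + j * (r%:Z * m.+1%:Z))%R.

Lemma wev_ext n m (f g : word n m) :
  (forall i : 'I_n.+1, wev f i = wev g i) -> forall x, wev f x = wev g x.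
Proof. by move=> e x; have [i [q ->]] := int_split n x; rewrite !wev_period e. Qed.

Lemma dmap_lift_pred0 n m (f : dmap n m) :
  dmap_lift f (-1)%R = ((f ord_max)%:Z - m.+1%:Z)%R.
Proof.
have -> : (-1 = (@ord_max n)%:Z + (-1) * n.+1%:Z)%R by rewrite /=; lia.
by rewrite dmap_liftE; lia.
Qed.

Lemma dmap_lift_predS n m (f : dmap n m) (i j : 'I_n.+1) : i = j.+1 :> nat ->
  dmap_lift f (i%:Z - 1)%R = Posz (f j).
Proof. by move=> eij; rewrite -dmap_liftE0; congr dmap_lift; lia. Qed.

(** Every relation between generators holds exactly on the integers, except the order of [tau],
    whose sides differ by [r] turns. Composition respects this ambiguity because periodicity turns
    [r] turns of the source into [r] turns of the target. *)
Lemma weq_wev r n m (f g : word n m) : weq r f g -> wev_eq r f g.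
Proof.
have exact_eq p q (u v : word p q) : (forall i : 'I_p.+1, wev u i = wev v i) ->
    wev_eq r u v.
  by move/wev_ext=> e; exists 0%R => x; rewrite e mul0r addr0.
elim=> {n m f g}.
- by move=> n m f; apply: exact_eq.
- by move=> n m f g _ [j e]; exists (- j)%R => x; rewrite e; lia.
- by move=> n m f g h _ [j e] _ [k e']; exists (j + k)%R => x; rewrite e e'; lia.
- move=> n m p f f' g g' _ [j e] _ [k e']; exists (j + k)%R => x /=.
  by rewrite e' mulrA wev_period e; lia.
- by move=> *; apply: exact_eq.
- by move=> *; apply: exact_eq.
- by move=> *; apply: exact_eq.
- by move=> n f e; apply: exact_eq => i /=; rewrite dmap_liftE0 e.
- by move=> n m p f g h e; apply: exact_eq => i /=; rewrite !dmap_liftE0 e.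
- by move=> n; apply: exact_eq => i /=; lia.
- by move=> n; apply: exact_eq => i /=; lia.
- move=> n i j eij; apply: exact_eq => x /=; rewrite dmap_liftE0.
  case: x => [[|x] ltx].
    by rewrite /= dmap_lift_pred0 /= /bump; case: i j eij => [i ?] [j ?] /=; lia.
  have ltx' : x < n.+1 by lia.
  rewrite (@dmap_lift_predS _ _ _ _ (Ordinal ltx')) //= /bump.
  by case: i j eij => [i ?] [j ?] /=; lia.
- move=> n; apply: exact_eq => x /=; rewrite !dmap_liftE0 /= /bump.
  by have := ltn_ord x; lia.
- move=> n i j eij; apply: exact_eq => x /=; rewrite dmap_liftE0 codeg_funE.
  case: x => [[|x] ltx].
    rewrite /= dmap_lift_pred0 codeg_funE /=.
    by case: i j eij => [i ?] [j ?] /=; case: leqP; lia.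
  have ltx' : x < n.+2 by lia.
  rewrite (@dmap_lift_predS _ _ _ _ (Ordinal ltx')) //= codeg_funE /=.
  by case: i j eij => [i ?] [j ?] /=; case: (leqP x j); case: (leqP x.+1 i); lia.
- move=> n; apply: exact_eq => x /=; rewrite dmap_liftE0 codeg_funE.
  case: x => [[|[|x]] ltx].
  (* The two factors [tau] take 0 to -2, which is the element [n] of the preceding period, of length
     [n.+2]. *)
  + have -> : (0%:Z - 1 - 1 = n%:Z + (-1) * n.+2%:Z)%R by lia.
    have := @dmap_liftE _ _ (@codeg n ord_max) (inord n) (-1)%R.
    by rewrite inordK //= => ->; rewrite codeg_funE /= inordK // leqnn; lia.
  + have -> : (1%N%:Z - 1 - 1 = (@ord_max n.+1)%:Z + (-1) * n.+2%:Z)%R.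
      by rewrite /=; lia.
    by rewrite dmap_liftE codeg_funE /= ltnn; lia.
  + have ltx' : x < n.+2 by lia.
    have -> : (x.+2%:Z - 1 - 1 = (Ordinal ltx'))%R by rewrite /=; lia.
    by rewrite dmap_liftE0 codeg_funE /=; case: leqP; lia.
- by move=> n; exists (-1)%R => x; rewrite wev_tauX /=; lia.
Qed.

(** * Normal forms and completeness of the cyclic relations *)

(** The exponents on the two sides may differ: [tau] disappears when it passes the coface 0 and
    doubles when it passes the codegeneracy 0. *)
Definition tau_slides r n m (f : dmap n m) : Prop :=
  forall k : nat, exists (g : dmap n m) (l : nat),
    weq r (wcomp (tauX m k) (wdelta f)) (wcomp (wdelta g) (tauX n l)).

Lemma tauX_add r n k l : weq r (wcomp (tauX n k) (tauX n l)) (tauX n (k + l)).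
Proof.
elim: k => [|k IHk] /=; first exact: weq_1m.
apply: weq_trans (weq_sym (weq_A _ _ _ _)) _.
exact: weq_comp (weq_refl _ _) IHk.
Qed.

Lemma tau_slides_family r n m (I : Type) (F : I -> dmap n m) :
  (forall i, exists j l,
    weq r (wcomp (wtau m) (wdelta (F i))) (wcomp (wdelta (F j)) (tauX n l))) ->
  forall i, tau_slides r (F i).
Proof.
move=> slide i k.
suff [j [l e]] : exists j l, weq r (wcomp (tauX m k) (wdelta (F i)))
    (wcomp (wdelta (F j)) (tauX n l)) by exists (F j), l.
elim: k => [|k [j [l e]]] /=.
  by exists i, 0; apply: weq_trans (weq_1m _ _) (weq_sym (weq_m1 _ _)).
have [j' [l' e']] := slide j; exists j', (l' + l).
apply: weq_trans (weq_sym (weq_A _ _ _ _)) _.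
apply: weq_trans (weq_comp (weq_refl _ _) e) _.
apply: weq_trans (weq_A _ _ _ _) _.
apply: weq_trans (weq_comp e' (weq_refl _ _)) _.
apply: weq_trans (weq_sym (weq_A _ _ _ _)) _.
exact: weq_comp (weq_refl _ _) (tauX_add _ _ _ _).
Qed.

Lemma dmap_comp_mono n m p (f : dmap m p) (g : dmap n m) (i j : 'I_n.+1) :
  i <= j -> (f \o g) i <= (f \o g) j.
Proof. by move=> leij; do 2!apply: dmono. Qed.

Definition dmap_comp n m p (f : dmap m p) (g : dmap n m) : dmap n p :=
  DMap (@dmap_comp_mono n m p f g).

Lemma weq_delta_ext r n m (f g : dmap n m) :
  f =1 g -> weq r (wdelta f) (wdelta g).
Proof.
move=> e; apply: weq_trans (weq_sym (weq_m1 _ _)) _.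
have d1 : weq r (wdelta (DMap (fun i j => id : i <= j -> i <= j))) (wid n).
  exact: weq_delta1.
apply: weq_trans (weq_comp (weq_refl _ _) (weq_sym d1)) _.
by apply: weq_deltaM => i; rewrite /= e.
Qed.

Lemma tau_slides_comp r n m p (f : dmap m p) (g : dmap n m) (h : dmap n p) :
  h =1 f \o g -> tau_slides r f -> tau_slides r g -> tau_slides r h.
Proof.
move=> eh sf sg k; have [f' [l ef]] := sf k; have [g' [l' eg]] := sg l.
exists (dmap_comp f' g'), l'.
apply: weq_trans (weq_comp (weq_refl _ _) (weq_sym (weq_deltaM _ eh))) _.
apply: weq_trans (weq_A _ _ _ _) _.
apply: weq_trans (weq_comp ef (weq_refl _ _)) _.
apply: weq_trans (weq_sym (weq_A _ _ _ _)) _.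
apply: weq_trans (weq_comp (weq_refl _ _) eg) _.
apply: weq_trans (weq_A _ _ _ _) _.
by apply: weq_comp (weq_refl _ _); apply: weq_deltaM.
Qed.

Lemma coface_slides r n (i : 'I_n.+2) : tau_slides r (coface i).
Proof.
apply: (tau_slides_family (F := @coface n)) => {i} -[[|i] lti].
  exists ord_max, 0; apply: weq_trans (weq_sym (weq_m1 _ _)).
  have -> : Ordinal lti = ord0 by apply: val_inj.
  exact: weq_tau_coface0.
exists (Ordinal (ltnW lti)), 1.
apply: weq_trans (weq_comp (weq_refl _ _) (weq_sym (weq_m1 _ _))).
exact: weq_tau_coface.
Qed.

Lemma codeg_slides r n (i : 'I_n.+1) : tau_slides r (codeg i).
Proof.
apply: (tau_slides_family (F := @codeg n)) => {i} -[[|i] lti].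
  exists ord_max, 2; have -> : Ordinal lti = ord0 by apply: val_inj.
  exact: weq_tau_codeg0.
exists (Ordinal (ltnW lti)), 1.
apply: weq_trans (weq_comp (weq_refl _ _) (weq_sym (weq_m1 _ _))).
exact: weq_tau_codeg.
Qed.

(** Such a map is strictly increasing, so induction from below gives [k <= f k] and induction from
    the top gives [f k <= k]. *)
Lemma dmap_bij_id n m (f : dmap n m) : injective f ->
  (forall j, exists i, f i = j) -> n = m /\ forall i, f i = i :> nat.
Proof.
move=> injf surjf.
have enm : n = m.
  apply/succn_inj; rewrite -[LHS]card_ord -[RHS]card_ord -(card_codom injf).
  by apply: eq_card => j; rewrite !inE; apply/codomP; have [i <-] := surjf j; exists i.
subst m; split=> // i.
have ltf (j k : 'I_n.+1) : j < k -> f j < f k.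
  move=> ltjk; rewrite ltn_neqAle dmono ?(ltnW ltjk) // andbT.
  by apply: contraTneq ltjk => /ord_inj/injf->; rewrite ltnn.
have lef k : forall ltk : k < n.+1, k <= f (Ordinal ltk).
  elim: k => // k IHk ltk; apply: leq_ltn_trans (IHk (ltnW ltk)) _.
  exact: ltf.
have gef k : forall j : 'I_n.+1, j = n - k :> nat -> k <= n -> f j <= n - k.
  elim: k => [|k IHk] j ej lek; first by rewrite subn0 -ltnS.
  have ltk : n - k < n.+1 by lia.
  have := IHk (Ordinal ltk) erefl (ltnW lek).
  have := @ltf j (Ordinal ltk); rewrite ej /=; lia.
have := lef i (ltn_ord i); have := gef (n - i) i.
have -> : Ordinal (ltn_ord i) = i by apply: val_inj.
by have := ltn_ord i; lia.
Qed.

(** Splits off one generator in such a way that [n + m] drops, which is the measure of the induction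
    in [dmap_slides]. The equations between dimensions are kept explicit because dimensions index
    the types. *)
Lemma dmap_cases n m (f : dmap n m) :
  [\/ n = m /\ forall i, f i = i :> nat,
      exists n' (en : n = n'.+1) (g : dmap n' m) (i : 'I_n'.+1),
        forall k, f k = g (codeg i (cast_ord (congr1 S en) k))
    | exists m' (em : m = m'.+1) (g : dmap n m') (j : 'I_m'.+2),
        forall k, cast_ord (congr1 S em) (f k) = coface j (g k)].
Proof.
have [/injectiveP injf|/injectivePn[i [j neij eij]]] := boolP (injectiveb f).
  have [/forallP surjf|] := boolP [forall j, j \in codom f].
    apply: Or31; apply: dmap_bij_id => // j.
    by have /codomP[i ->] := surjf j; exists i.
  rewrite negb_forall => /existsP[j nj]; apply: Or33.
  case: m f injf j nj => [|m] f injf j nj.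
    have e : j = f ord0 by rewrite [LHS]ord1 [RHS]ord1.
    by rewrite e codom_f in nj.
  (* Since [j] is not a value of [f], the codegeneracy at [j] undoes the coface at [j] on the image.
     For the top value [j = m.+1] there is no such codegeneracy, and the last one does the same;
     hence the minimum. *)
  have lti : minn j m < m.+1 by lia.
  exists m, erefl, (dmap_comp (codeg (Ordinal lti)) f), j => k.
  apply: ord_inj; rewrite /= codeg_funE /= /bump.
  have : f k != j :> nat.
    by apply: contraNneq nj => /ord_inj<-; apply: codom_f.
  by have := ltn_ord (f k); have := ltn_ord j; case: ifP; lia.
apply: Or32; wlog ltij : i j neij eij / i < j.
  move=> wl; have [|//|e] := ltngtP i j; first exact: wl.
    by move=> ltji; apply: (wl j i) => //; rewrite eq_sym.
  by rewrite (ord_inj e) eqxx in neij.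
case: n f i j {neij} eij ltij => [|n] f i j eij ltij.
  by have := ltn_ord j; lia.
have lti : i < n.+1 by have := ltn_ord j; lia.
pose i1 : 'I_n.+2 := Ordinal (lti : i.+1 < n.+2).
exists n, erefl, (dmap_comp f (coface i1)), (Ordinal lti) => k.
(* Monotonicity squeezes the value at the successor of [i] between [f i] and [f j], so two
   neighbours have the same image. *)
have efi : f i1 = f i.
  apply/ord_inj/anti_leq; rewrite [X in _ && X]dmono //=.
  by rewrite eij dmono.
have [->|ne] := eqVneq k i1.
  rewrite efi /=; congr (f _); apply: ord_inj; rewrite /= codeg_funE /= /bump.
  by case: ifP; lia.
congr (f _); apply: ord_inj; rewrite /= codeg_funE /= /bump.
by move: ne; rewrite -val_eqE /=; case: ifP; lia.
Qed.

Lemma dmap_slides r n m (f : dmap n m) : tau_slides r f.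
Proof.
have [N leN] := ubnP (n + m); elim: N => // N IHN in n m f leN *.
have [[enm ef]|[n' [en [g [i ef]]]]|[m' [em [g [j ef]]]]] := dmap_cases f.
- subst m; have f1 : weq r (wdelta f) (wid n).
    by apply: weq_delta1 => i; apply: ord_inj.
  move=> k; exists f, k; apply: weq_trans (weq_comp (weq_refl _ _) f1) _.
  apply: weq_trans (weq_m1 _ _) _; apply: weq_sym.
  by apply: weq_trans (weq_comp f1 (weq_refl _ _)) _; apply: weq_1m.
- subst n; apply: (@tau_slides_comp _ _ _ _ g (codeg i)) (codeg_slides _ _).
    by move=> k; rewrite ef cast_ord_id.
  by apply: IHN; lia.
- subst m; apply: (@tau_slides_comp _ _ _ _ (coface j) g) (coface_slides _ _) _.
    by move=> k; have := ef k; rewrite cast_ord_id.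
  by apply: IHN; lia.
Qed.

Lemma weq_normal r n m (w : word n m) : 0 < r ->
  exists (f : dmap n m) (k : nat), weq r w (wcomp (wdelta f) (tauX n k)).
Proof.
move=> r_gt0.
have d1 p : weq r (wdelta (DMap (fun i j => id : i <= j -> i <= j))) (wid p).
  exact: weq_delta1.
have tauw p (v : word p p) k : weq r v (tauX p k) ->
    exists (f : dmap p p) k, weq r v (wcomp (wdelta f) (tauX p k)).
  move=> e; exists (DMap (fun i j => id : i <= j -> i <= j)), k.
  apply: weq_trans e _; apply: weq_trans (weq_sym (weq_1m _ _)) _.
  exact: weq_comp (weq_sym (d1 _)) (weq_refl _ _).
elim: w => {n m} [n|n m p u [f [k eu]] v [g [l ev]]|n m f|n|n].
- exact: (tauw _ _ 0 (weq_refl _ _)).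
- have [h [k' e]] := dmap_slides r g k; exists (dmap_comp f h), (k' + l).
  apply: weq_trans (weq_comp eu ev) _.
  apply: weq_trans (weq_sym (weq_A _ _ _ _)) _.
  apply: weq_trans (weq_comp (weq_refl _ _) (weq_A _ _ _ _)) _.
  apply: weq_trans (weq_comp (weq_refl _ _) (weq_comp e (weq_refl _ _))) _.
  apply: weq_trans (weq_comp (weq_refl _ _) (weq_sym (weq_A _ _ _ _))) _.
  apply: weq_trans (weq_A _ _ _ _) _.
  by apply: weq_comp (tauX_add _ _ _ _); apply: weq_deltaM.
- by exists f, 0; apply: weq_sym (weq_m1 _ _).
- by apply: (tauw _ _ 1); apply: weq_sym (weq_m1 _ _).
(* As [r] is positive, the finite order of [tau] makes its inverse a nonnegative power. *)
- apply: (tauw _ _ (r * n.+1).-1).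
  have e : weq r (wcomp (wtau n) (tauX n (r * n.+1).-1)) (wid n).
    by have := weq_tau_order r n; case: (r * n.+1) (muln_gt0 r n.+1) => //; lia.
  apply: weq_trans (weq_sym (weq_m1 _ _)) _.
  apply: weq_trans (weq_comp (weq_refl _ _) (weq_sym e)) _.
  apply: weq_trans (weq_A _ _ _ _) _.
  by apply: weq_trans (weq_comp (weq_tauK _ _) (weq_refl _ _)) _; apply: weq_1m.
Qed.

Lemma tauX_congr r n k l (j : int) : (k%:Z = l%:Z + j * (r * n.+1)%N%:Z)%R ->
  weq r (tauX n k) (tauX n l).
Proof.
have mul i : weq r (tauX n (i * (r * n.+1))) (wid n).
  elim: i => [|i IHi]; first exact: weq_refl.
  rewrite mulSn; apply: weq_trans (weq_sym (tauX_add _ _ _ _)) _.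
  by apply: weq_trans (weq_comp (weq_tau_order _ _) IHi) _; apply: weq_1m.
have add i p : weq r (tauX n (i * (r * n.+1) + p)) (tauX n p).
  apply: weq_trans (weq_sym (tauX_add _ _ _ _)) _.
  by apply: weq_trans (weq_comp (mul _) (weq_refl _ _)) _; apply: weq_1m.
case: j => j e; first by have -> : k = j * (r * n.+1) + l by lia.
by apply: weq_sym; have -> : l = j.+1 * (r * n.+1) + k by lia.
Qed.

(** Completeness of the relations. By periodicity the ambiguity of [r] turns in the target can be
    moved into the argument, where it alters the exponent of [tau] by a multiple of its order; it
    remains to recover exponent and simplicial map from the lift. *)
Lemma wev_weq r n m (f g : word n m) : 0 < r -> wev_eq r f g -> weq r f g.
Proof.
move=> r_gt0 [J efg].
have [d [k ef]] := weq_normal f r_gt0; have [d' [k' eg]] := weq_normal g r_gt0.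
have [J1 e1] := weq_wev ef; have [J2 e2] := weq_wev eg.
pose j : int := (J + J2 - J1)%R.
have e (x : int) : dmap_lift d (x - k%:Z)%R =
    (dmap_lift d' (x - k'%:Z)%R + j * (r%:Z * m.+1%:Z))%R.
  by have := efg x; rewrite e1 e2 /= !wev_tauX /j; lia.
have ge0 (c : dmap n m) (y : int) : (0 <= dmap_lift c y)%R = (0 <= y)%R.
  have [i [q ->]] := int_split n y; rewrite dmap_liftE.
  have lti := ltn_ord i; have ltc := ltn_ord (c i).
  by case: q => q; rewrite ?NegzE; apply/idP/idP; lia || nia.
have period (x : int) : (dmap_lift d' x + j * (r%:Z * m.+1%:Z))%R =
    dmap_lift d' (x + (j * r%:Z) * n.+1%:Z)%R.
  by rewrite -[dmap_lift d']/(wev (wdelta d')) wev_period mulrA.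
(* The two sides of [e] become nonnegative at [k] and at [k' - j * r * (n + 1)]; comparing signs at
   both points shows that these agree. *)
have ek : (k%:Z = k'%:Z - j * (r * n.+1)%N%:Z)%R.
  have h1 := ge0 d (k%:Z - k%:Z)%R.
  have h2 := ge0 d (k'%:Z - j * r%:Z * n.+1%:Z - k%:Z)%R.
  rewrite e period ge0 in h1; rewrite e period ge0 in h2; lia.
apply: weq_trans ef _; apply: weq_trans (weq_sym eg).
apply: weq_comp; last by apply: (tauX_congr (j := (- j)%R)); lia.
apply: weq_delta_ext => i; apply: ord_inj.
have := e (i%:Z + k%:Z)%R; rewrite period addrK dmap_liftE0.
have -> : (i%:Z + k%:Z - k'%:Z + j * r%:Z * n.+1%:Z = i)%R by lia.
by rewrite dmap_liftE0 => -[].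
Qed.

(** * Isomorphisms as translations, and maps onto two points *)

Lemma int_split_uniq n (i j : 'I_n.+1) (p q : int) :
  (i%:Z + p * n.+1%:Z = j%:Z + q * n.+1%:Z)%R -> i = j /\ p = q.
Proof.
move=> e; suff epq : p = q by split=> //; apply: ord_inj; rewrite epq in e; lia.
have := ltn_ord i; have := ltn_ord j.
have : p = q \/ (p + 1 <= q \/ q + 1 <= p)%R by lia.
by case=> [//|[]] le; nia.
Qed.

Lemma dmap_shift_mono n m (i j : 'I_n.+1) : i <= j ->
  (inord (minn i m) : 'I_m.+1) <= (inord (minn j m) : 'I_m.+1).
Proof. by rewrite !inordK ?ltnS ?geq_minr //; lia. Qed.

(* Meant for [n = m], where it is translation by [t]; allowing [n] and [m] to be
   only provably equal avoids casts. *)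
Definition wshift n m (t : int) : word n m :=
  wcomp (wdelta (DMap (@dmap_shift_mono n m))) (tauZ n (- t)%R).

Lemma wev_wshift n m t x : n = m -> wev (wshift n m t) x = (x + t)%R.
Proof.
move=> <-; rewrite /wshift /= wev_tauZ opprK.
have [i [q ->]] := int_split n (x + t)%R; rewrite dmap_liftE /=.
by rewrite inordK; have := ltn_ord i; lia.
Qed.

(** On the integers [g] inverts [w] only up to translations, but this still makes both strictly
    increasing. If [w] skipped an integer between [x] and [x + 1], then [g] would have to fit one
    strictly between two consecutive integers. So [w] advances by unit steps, and comparing periods
    gives [n = m]. *)
Lemma wev_iso_shift r n m (w : word n m) :
  @is_iso (Lambda r) n m w -> n = m /\ forall x, wev w x = (x + wev w 0)%R.
Proof.
case=> g [/weq_wev[c gw] /weq_wev[c' wg]].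
pose d : int := (c * (r%:Z * n.+1%:Z))%R; pose d' : int := (c' * (r%:Z * m.+1%:Z))%R.
have {gw} gw (x : int) : wev g (wev w x) = (x + d)%R by exact: gw.
have {wg} wg (x : int) : wev w (wev g x) = (x + d')%R by exact: wg.
have ltw (x y : int) : (x < y)%R -> (wev w x < wev w y)%R.
  move=> ltxy; have := @wev_mono _ _ w x y; have := gw x; have := gw y.
  by have [->|] := eqVneq (wev w x) (wev w y); lia.
have ltg (x y : int) : (x < y)%R -> (wev g x < wev g y)%R.
  move=> ltxy; have := @wev_mono _ _ g x y; have := wg x; have := wg y.
  by have [->|] := eqVneq (wev g x) (wev g y); lia.
have wS (x : int) : wev w (x + 1)%R = (wev w x + 1)%R.
  have h1 := ltw x (x + 1)%R; have [|] := boolP (wev w x + 1 < wev w (x + 1))%R.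
    move=> /ltg; rewrite gw; have := @ltg (wev w x) (wev w x + 1)%R.
    by rewrite gw; lia.
  by lia.
have wN (k : nat) (x : int) : wev w (x + k%:Z)%R = (wev w x + k%:Z)%R.
  elim: k => [|k IHk]; first by rewrite !addr0.
  have e : (x + k.+1%:Z = x + k%:Z + 1)%R by lia.
  by rewrite e wS IHk; lia.
split.
  have := wev_period w 0 1; have := wN n.+1 0%R; rewrite !mul1r => -> e.
  by move: e; lia.
case=> k; first by have := wN k 0%R; rewrite add0r addrC.
rewrite NegzE; have := wN k.+1 (- k.+1%:Z)%R.
have -> : (- k.+1%:Z + k.+1%:Z = 0)%R by lia.
by move=> ->; lia.
Qed.

Lemma wev_shift_iso r n m (w : word n m) (t : int) : 0 < r -> n = m ->
  (forall x, wev w x = (x + t)%R) -> @is_iso (Lambda r) n m w.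
Proof.
move=> r_gt0 enm wE; exists (wshift m n (- t)%R).
split; apply/wev_weq => //; exists 0%R => x; rewrite mul0r addr0.
  rewrite -[LHS]/(wev (wshift m n (- t)%R) (wev w x)) wev_wshift // wE.
  by rewrite addrK.
rewrite -[LHS]/(wev w (wev (wshift m n (- t)%R) x)) wE wev_wshift //.
by rewrite subrK.
Qed.

Lemma wev_identity r n m (w : word n m) (j : int) : 0 < r -> n = m ->
  (forall x, wev w x = (x + j * (r%:Z * m.+1%:Z))%R) ->
  @is_identity (Lambda r) n m w.
Proof.
move=> r_gt0 enm; subst m => wE; constructor.
by apply/wev_weq => //; exists j => x; rewrite wE.
Qed.

Lemma identity_wev r n m (w : word n m) : @is_identity (Lambda r) n m w ->
  exists j : int, forall x, wev w x = (x + j * (r%:Z * m.+1%:Z))%R.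
Proof. by case=> f /weq_wev[j e]; exists j => x; rewrite e. Qed.

(** The staircase that all half-edge maps share up to translation of argument and value. *)
Definition two_step n : int -> int := dmap_lift (phi_first n).

Lemma two_step_period n (z q : int) :
  two_step n (z + q * n.+1%:Z)%R = (two_step n z + q * 2)%R.
Proof. exact: (wev_period (wdelta (phi_first n))). Qed.

Lemma two_stepE n (i : 'I_n.+1) : two_step n i = Posz (i != 0 :> nat).
Proof. by rewrite /two_step dmap_liftE0 /= inordK // ltnS leq_b1. Qed.

(** Strictly between [p] and its next translate, the values exceed that at [p] by an odd number,
    since [word_fun w] separates [p] from the rest. Monotonicity bounds this number by the period 2
    of the target, so it is 1. *)
Lemma wev_two_step n m (w : word n m) (p : 'I_n.+1) : m = 1 ->
  (forall i, i != p -> word_fun w i != word_fun w p) ->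
  forall z : int, wev w z = (two_step n (z - p%:Z) + wev w p)%R.
Proof.
move=> em neq z; subst m.
have [i [k ez]] := int_split n (z - p%:Z)%R.
have {ez} -> : z = (i%:Z + p%:Z + k * n.+1%:Z)%R by lia.
have -> : (i%:Z + p%:Z + k * n.+1%:Z - p%:Z = i%:Z + k * n.+1%:Z)%R by lia.
rewrite wev_period two_step_period two_stepE.
suff e : wev w (i%:Z + p%:Z)%R = ((i != 0 :> nat)%:Z + wev w p)%R by rewrite e; lia.
have [->|i0] := eqVneq (i : nat) 0; first by rewrite add0r add0r.
have [j [l ej]] := int_split n (i%:Z + p%:Z)%R.
have nej : j != p.
  apply/eqP => ejp; rewrite ejp in ej.
  have := @int_split_uniq n i ord0 0 l; case=> [|ei _]; first by rewrite /=; lia.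
  by rewrite ei in i0.
have [a ea] := wev_word_fun w p; have [b eb] := wev_word_fun w j.
have := neq j nej; rewrite -val_eqE /=.
have := ltn_ord (word_fun w p); have := ltn_ord (word_fun w j).
have le1 : (wev w p <= wev w (i%:Z + p%:Z))%R by apply: wev_mono; lia.
have : (wev w (i%:Z + p%:Z) <= wev w (p%:Z + 1 * n.+1%:Z))%R.
  by apply: wev_mono; have := ltn_ord i; lia.
by rewrite wev_period; move: le1; rewrite ej wev_period ea eb; lia.
Qed.

(** * Structures on graphs, up to isomorphism *)

Definition Lev r G (A : Lstruct r G) x y (f : Ahom x y) : int -> int :=
  @wev (A x) (A y) (@fmap (Acat G) (Lambda r) A x y f).

Definition Ldeg r G (A : Lstruct r G) (x : Aob G) : nat := A x.

Lemma Lmu_bij r G (A : Lstruct r G) x : bijective (Lmu A x).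
Proof. by have [g [gK Kg]] := Lmu_iso A x; exists g. Qed.

Lemma Ldeg_edge r G (A : Lstruct r G) e : Ldeg A (Aedge e) = 1.
Proof.
have bij := @Lmu_bij r G A (Aedge e); apply/succn_inj; rewrite -[LHS]card_ord.
rewrite (bij_eq_card (bij : @bijective {h | h \in val e} 'I_(Ldeg A (Aedge e)).+1 _)).
rewrite card_sig; case: e {bij} => E /= /existsP[h /andP[nh /eqP->]].
by rewrite (eq_card (B := [set h; ginv h])) ?cards2 1?eq_sym ?nh // => k; rewrite !inE.
Qed.

Lemma Ldeg_ext r G (A : Lstruct r G) h : Ldeg A (Aext h) = 1.
Proof.
have bij := @Lmu_bij r G A (Aext h); apply/succn_inj; rewrite -[LHS]card_ord.
by rewrite (bij_eq_card (bij : @bijective 'I_2 'I_(Ldeg A (Aext h)).+1 _)) card_ord.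
Qed.

Lemma gedge_ginv G (e : gedge G) h : h \in val e -> ginv h != h.
Proof.
case: e => E /= /existsP[k /andP[nk /eqP->]]; rewrite !inE.
by case/orP=> /eqP-> //; rewrite ginvK eq_sym.
Qed.

Lemma Lmu_edge r G (A : Lstruct r G) (h : halfedge G) (e : gedge G)
  (he : h \in val e) i :
  val (Lmu A (Aedge e) (@word_fun (A (Avert (gsrc h))) (A (Aedge e))
    (@fmap (Acat G) (Lambda r) A _ _ (Ainc he)) i)) =
  if val (Lmu A (Avert (gsrc h)) i) == h then ginv h else h.
Proof.
have /= -> := @ncompE _ _ _ _ (Lmu A) _ _ (Ainc he) i.
by case: ifP.
Qed.

Lemma Lmu_extE r G (A : Lstruct r G) (h : external G) i :
  (Lmu A (Aext h) (@word_fun (A (Avert (gsrc (val h)))) (A (Aext h))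
    (@fmap (Acat G) (Lambda r) A _ _ (Aincx h)) i) : nat) =
  ((val (Lmu A (Avert (gsrc (val h))) i) == val h) (+) ~~ incoming (val h) : bool).
Proof.
have /= -> := @ncompE _ _ _ _ (Lmu A) _ _ (Aincx h) i.
by rewrite inordK ?ltnS; case: incoming; rewrite ?leq_b1 ?addbF ?addbT.
Qed.

Lemma Lev_inc r G (A : Lstruct r G) (h : halfedge G) (e : gedge G)
  (he : h \in val e)
  (p : 'I_(Ldeg A (Avert (gsrc h))).+1) :
  val (Lmu A (Avert (gsrc h)) p) = h -> forall z,
  Lev A (Ainc he) z =
  (two_step (Ldeg A (Avert (gsrc h))) (z - p%:Z) + Lev A (Ainc he) p)%R.
Proof.
move=> ph; apply: wev_two_step; first exact: Ldeg_edge.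
move=> i; apply: contraNneq => e'; have := @Lmu_edge r G A h e he i; rewrite [word_fun _ _]e'.
rewrite (@Lmu_edge r G A h e he p) ph eqxx; case: ifP => [/eqP ih _|_ ne].
  apply/eqP/(bij_inj (@Lmu_bij r G A (Avert (gsrc h)))).
  by apply: val_inj; rewrite /= ih ph.
by have := gedge_ginv he; rewrite ne eqxx.
Qed.

Lemma Lev_ext r G (A : Lstruct r G) (h : external G)
  (p : 'I_(Ldeg A (Avert (gsrc (val h)))).+1) :
  val (Lmu A (Avert (gsrc (val h))) p) = val h -> forall z,
  Lev A (Aincx h) z =
  (two_step (Ldeg A (Avert (gsrc (val h)))) (z - p%:Z) + Lev A (Aincx h) p)%R.
Proof.
move=> ph; apply: wev_two_step; first exact: Ldeg_ext.
move=> i; apply: contraNneq => e'; have := @Lmu_extE r G A h i; rewrite [word_fun _ _]e'.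
rewrite (@Lmu_extE r G A h p) ph eqxx; case: (eqVneq _ (val h)) => [ih _|_].
  apply/eqP/(bij_inj (@Lmu_bij r G A (Avert (gsrc (val h))))).
  by apply: val_inj; rewrite /= ih ph.
by case: incoming.
Qed.

(** Naturality is an equation in the r-cyclic category and lifts only up to [r] turns. For the same
    reason an identity at an external half-edge yields a multiple of [2r] and not 0. *)
Lemma Lstruct_iso_shift r G (A B : Lstruct r G) : Lstruct_iso A B ->
  exists T : Aob G -> int,
  [/\ forall x, Ldeg A x = Ldeg B x,
      forall x (i : 'I_(Ldeg A x).+1) (j : 'I_(Ldeg B x).+1) (q : int),
        (i%:Z + T x = j%:Z + q * (Ldeg B x).+1%:Z)%R -> Lmu B x j = Lmu A x i,
      forall x y (f : Ahom x y), exists k : int, forall z,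
        (Lev A f z + T y = Lev B f (z + T x) + k * (r%:Z * (Ldeg B y).+1%:Z))%R
    & forall h, exists k : int, T (Aext h) = (k * (r%:Z * 2))%R].
Proof.
case=> theta [iso_th mu_th id_th].
pose w x : word (Ldeg A x) (Ldeg B x) := theta x.
have sh x := @wev_iso_shift r (Ldeg A x) (Ldeg B x) (w x) (iso_th x).
exists (fun x => wev (w x) 0); split.
- by move=> x; have [] := sh x.
- move=> x i j q ij; have [_ e] := sh x; rewrite -(mu_th x i) /=; congr (Lmu B x _).
  have [q' eq'] := wev_word_fun (w x) i; rewrite e ij in eq'.
  rewrite -/(w x); move: (word_fun _ _) eq' => j' eq'.
  by have [->] := int_split_uniq eq'.
- move=> x y f; have /weq_wev[k ek] := ncompE theta f.
  exists k => z; have [_ ey] := sh y; have [_ ex] := sh x.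
  by have := ek z; rewrite /= -/(w y) -/(w x) (ex z) (ey (wev _ _)).
- move=> h; have /identity_wev[k ek] := id_th h; exists k.
  have := ek 0%R; rewrite -/(w _) add0r => ->.
  by rewrite -/(Ldeg B (Aext h)) Ldeg_ext.
Qed.

Lemma gedge_mem_cases G (e : gedge G) h k : h \in val e -> k \in val e ->
  k = h \/ k = ginv h.
Proof.
case: e => E /= /existsP[l /andP[_ /eqP->]]; rewrite !inE.
by move=> /orP[]/eqP-> /orP[]/eqP->; rewrite ?ginvK; auto.
Qed.

(** The converse asks for much less: each half-edge map is compared at a single integer, and nothing
    is required of the bijections at edges. *)
Lemma Lstruct_shift_iso r G (A B : Lstruct r G) (T : Aob G -> int) : 0 < r ->
  (forall v, Ldeg A (Avert v) = Ldeg B (Avert v)) ->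
  (forall v (i : 'I_(Ldeg A (Avert v)).+1) (j : 'I_(Ldeg B (Avert v)).+1) (q : int),
    (i%:Z + T (Avert v) = j%:Z + q * (Ldeg B (Avert v)).+1%:Z)%R ->
    Lmu B (Avert v) j = Lmu A (Avert v) i) ->
  (forall h (e : gedge G) (he : h \in val e) (i : 'I_(Ldeg A (Avert (gsrc h))).+1),
    val (Lmu A (Avert (gsrc h)) i) = h -> exists k : int,
    (Lev A (Ainc he) i + T (Aedge e) =
     Lev B (Ainc he) (i%:Z + T (Avert (gsrc h))) + k * (r%:Z * 2))%R) ->
  (forall h (i : 'I_(Ldeg A (Avert (gsrc (val h)))).+1),
    val (Lmu A (Avert (gsrc (val h))) i) = val h -> exists k : int,
    (Lev A (Aincx h) i =
     Lev B (Aincx h) (i%:Z + T (Avert (gsrc (val h)))) + k * (r%:Z * 2))%R) ->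
  (forall h, T (Aext h) = 0%R) ->
  Lstruct_iso A B.
Proof.
move=> r_gt0 degV muV incE incX TX.
have deg x : Ldeg A x = Ldeg B x.
  by case: x => [v|e|h]; rewrite ?Ldeg_edge ?Ldeg_ext.
have corr v (i : 'I_(Ldeg A (Avert v)).+1) :
    exists (j : 'I_(Ldeg B (Avert v)).+1) (q : int),
      (i%:Z + T (Avert v) = j%:Z + q * (Ldeg B (Avert v)).+1%:Z)%R /\
      Lmu B (Avert v) j = Lmu A (Avert v) i.
  have [j [q ij]] := int_split (Ldeg B (Avert v)) (i%:Z + T (Avert v))%R.
  by exists j, q; split=> //; exact: muV ij.
have natE x y (f : Ahom x y) : exists k : int, forall z,
    (Lev A f z + T y = Lev B f (z + T x) + k * (r%:Z * (Ldeg B y).+1%:Z))%R.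
  (* Both sides are translates of one staircase, so agreement at the position of the half-edge
     spreads to all integers. *)
  have step v n m (F G' : int -> int) (u k p p' q : int) :
      n = Ldeg B (Avert v) ->
      (forall z : int, F z = two_step n (z - p) + F p)%R ->
      (forall z : int, G' z = two_step (Ldeg B (Avert v)) (z - p') + G' p')%R ->
      (p + T (Avert v) = p' + q * (Ldeg B (Avert v)).+1%:Z)%R -> m = 1 ->
      (F p + u = G' (p + T (Avert v)) + k * (r%:Z * 2))%R -> forall z,
      (F z + u = G' (z + T (Avert v)) + k * (r%:Z * m.+1%:Z))%R.
    move=> -> FE GE pp' -> Fp z.
    rewrite GE pp' in Fp; rewrite FE GE.
    have -> : (z + T (Avert v) - p' = (z - p) + q * (Ldeg B (Avert v)).+1%:Z)%R by lia.
    have e : (p' + q * (Ldeg B (Avert v)).+1%:Z - p' =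
              0 + q * (Ldeg B (Avert v)).+1%:Z)%R by lia.
    rewrite e two_step_period (two_stepE (ord0 : 'I_(Ldeg B (Avert v)).+1)) /= in Fp.
    by rewrite two_step_period; lia.
  case: f => {x y} [x|h e he|h].
  - have /weq_wev[k ek] := fmap1 A x; have /weq_wev[l el] := fmap1 B x.
    exists (k - l)%R => z; have := ek z; have := el (z + T x)%R.
    rewrite /Lev => -> ->; have -> : A x = Ldeg B x by apply: deg.
    by rewrite /= -/(Ldeg B x); lia.
  - have [g _ Kg] := @Lmu_bij r G A (Avert (gsrc h)).
    pose i := g (exist _ h (eqxx _)); have hi : val (Lmu A (Avert (gsrc h)) i) = h.
      by rewrite Kg.
    have [j [q [ij mij]]] := corr _ i; have [k ek] := incE h e he i hi.
    exists k; apply: (step _ _ _ _ _ _ _ _ _ q (deg _) (Lev_inc he hi) _ ij _ ek).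
      by apply: Lev_inc; rewrite mij.
    exact: Ldeg_edge.
  - have [g _ Kg] := @Lmu_bij r G A (Avert (gsrc (val h))).
    pose i := g (exist _ (val h) (eqxx _)).
    have hi : val (Lmu A (Avert (gsrc (val h))) i) = val h by rewrite Kg.
    have [j [q [ij mij]]] := corr _ i; have [k ek] := incX h i hi.
    exists k; apply: (step _ _ _ _ _ _ _ _ _ q (deg _) (Lev_ext hi) _ ij).
    + by apply: Lev_ext; rewrite mij.
    + exact: Ldeg_ext.
    + by rewrite TX addr0.
(* Compatibility with the bijections at an edge follows by reducing the congruence at one half-edge
   modulo 2: the two structures then agree on which element represents the opposite half-edge. *)
have muE e (i : 'I_(Ldeg A (Aedge e)).+1) (j : 'I_(Ldeg B (Aedge e)).+1) (q : int) :
    (i%:Z + T (Aedge e) = j%:Z + q * (Ldeg B (Aedge e)).+1%:Z)%R ->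
    Lmu B (Aedge e) j = Lmu A (Aedge e) i.
  move=> ij; have [h he] : exists h, h \in val e.
    by case: {+}e => E /= /existsP[h /andP[_ /eqP->]]; exists h; rewrite set21.
  have [g _ Kg] := @Lmu_bij r G A (Avert (gsrc h)).
  pose i0 := g (exist _ h (eqxx _)).
  have hi : val (Lmu A (Avert (gsrc h)) i0) = h by rewrite Kg.
  have [j0 [q0 [ij0 mij]]] := corr _ i0; have [k ek] := incE h e he i0 hi.
  have hj : val (Lmu B (Avert (gsrc h)) j0) = h by rewrite mij.
  have mA := @Lmu_edge r G A h e he i0; rewrite hi eqxx in mA.
  have mB := @Lmu_edge r G B h e he j0; rewrite hj eqxx in mB.
  have [a ea] := @wev_word_fun (Ldeg A _) (Ldeg A _) (fmap A (Ainc he)) i0.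
  have [b eb] := @wev_word_fun (Ldeg B _) (Ldeg B _) (fmap B (Ainc he)) j0.
  set fA := word_fun _ i0 in ea mA; set fB := word_fun _ j0 in eb mB.
  have {ek} ek : (fA%:Z + a * 2 + T (Aedge e) = fB%:Z + (b + q0) * 2 + k * (r%:Z * 2))%R.
    have eA : (a * (Ldeg A (Aedge e)).+1%:Z = a * 2)%R by rewrite Ldeg_edge.
    have eB (c : int) : (c * (Ldeg B (Aedge e)).+1%:Z = c * 2)%R.
      by rewrite Ldeg_edge.
    move: ek; rewrite ij0 /Lev wev_period ea eb eA !eB => ek.
    by rewrite mulrDl addrA; exact: ek.
  have lt2 (C : Lstruct r G) (c : 'I_(Ldeg C (Aedge e)).+1) : c < 2.
    by rewrite -[X in _ < X.+1](@Ldeg_edge r G C e).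
  have := lt2 A fA; have := lt2 B fB; have := lt2 A i; have := lt2 B j.
  have {}ij : (i%:Z + T (Aedge e) = j%:Z + q * 2)%R.
    by rewrite ij; congr (_ + _ * _)%R; rewrite Ldeg_edge.
  move=> ltj lti ltfB ltfA.
  have sep (C : Lstruct r G) (c d : 'I_(Ldeg C (Aedge e)).+1) :
      val (Lmu C (Aedge e) d) = ginv h ->
      (c == d) = (val (Lmu C (Aedge e) c) == ginv h).
    move=> ed; apply/eqP/eqP => [-> //|]; rewrite -ed => /val_inj.
    exact: (bij_inj (@Lmu_bij r G C (Aedge e))).
  apply: val_inj; have := sep A i fA mA; have := sep B j fB mB.
  have arith (i' j' a' b' : nat) (u c d d' k' : int) : i' < 2 -> j' < 2 ->
      a' < 2 -> b' < 2 -> (i'%:Z + u = j'%:Z + c * 2)%R ->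
      (a'%:Z + d * 2 + u = b'%:Z + d' * 2 + k' * (r%:Z * 2))%R ->
      (j' == b') = (i' == a') by lia.
  have -> : (j == fB) = (i == fA).
    by rewrite -!val_eqE; exact: arith lti ltj ltfA ltfB ij ek.
  move=> ->.
  have nh := gedge_ginv he.
  have [->|->] := gedge_mem_cases he (valP (Lmu B (Aedge e) j));
    have [->|->] := gedge_mem_cases he (valP (Lmu A (Aedge e) i)) => //;
    by rewrite eqxx eq_sym (negbTE nh).
pose th x : word (Ldeg A x) (Ldeg B x) := wshift (Ldeg A x) (Ldeg B x) (T x).
have thE x z : wev (th x) z = (z + T x)%R by apply: wev_wshift.
have th_nat (x y : Acat G) (f : Defs.hom x y) :
    @heq (Lambda r) _ _ (@mcomp (Lambda r) _ _ _ (th y) (fmap A f))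
      (@mcomp (Lambda r) _ _ _ (fmap B f) (th x)).
  apply/wev_weq => //; have [k ek] := natE x y f; exists k => z.
  rewrite -[LHS]/(wev (th y) (Lev A f z)) thE ek.
  by rewrite -[X in _ = (X + _)%R]/(Lev B f (wev (th x) z)) thE.
exists (NatTrans th_nat); split.
- by move=> x; apply: (wev_shift_iso r_gt0 (deg x) (thE x)).
- move=> x i /=; have [q eq] := wev_word_fun (th x) i; rewrite thE in eq.
  case: x i q eq => [v|e|h] i q eq.
  + exact: muV eq.
  + exact: muE eq.
  + apply: ord_inj; rewrite !Lmu_ext; rewrite TX addr0 in eq.
    have {}eq : (i%:Z + 0 = (word_fun (th (Aext h)) i)%:Z + q * 2)%R.
      by rewrite addr0 [LHS]eq; congr (_ + _ * _)%R; rewrite Ldeg_ext.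
    have lt2 (C : Lstruct r G) (c : 'I_(Ldeg C (Aext h)).+1) : c < 2.
      by rewrite -[X in _ < X.+1](@Ldeg_ext r G C h).
    have := lt2 A i; have := lt2 B (word_fun (th (Aext h)) i).
    by move: eq; move: (nat_of_ord _) => x; move: (nat_of_ord _) => y; lia.
- move=> h; apply: (@wev_identity r _ _ (th (Aext h)) 0) => //.
  by move=> z; rewrite thE TX; lia.
Qed.

(** Replaces the multiples of [2r] at external half-edges by 0, as [Lstruct_shift_iso] expects; the
    congruences absorb the change. *)
Definition off_ext G (T : Aob G -> int) (x : Aob G) : int :=
  if x is Aext _ then 0%R else T x.

Lemma Lstruct_iso_sym r G (A B : Lstruct r G) : 0 < r ->
  Lstruct_iso A B -> Lstruct_iso B A.
Proof.
move=> r_gt0 /Lstruct_iso_shift[T [deg mu ev ext]].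
have ev' x y (f : Ahom x y) : exists k : int, forall z,
    (Lev B f z = Lev A f (z - T x) + T y + k * (r%:Z * (Ldeg A y).+1%:Z))%R.
  have [k ek] := ev x y f; exists (- k)%R => z.
  by rewrite ek deg subrK; lia.
apply: (Lstruct_shift_iso (T := off_ext (fun x => (- T x)%R))) => //=.
- move=> v i j q e; rewrite -(mu (Avert v) j i (- q)%R) //.
  have -> : (- q * (Ldeg B (Avert v)).+1%:Z = - q * (Ldeg A (Avert v)).+1%:Z)%R.
    by rewrite deg.
  by lia.
- move=> h e he i _; have [k ek] := ev' _ _ (Ainc he); exists k.
  by rewrite ek Ldeg_edge; lia.
- move=> h i _; have [k ek] := ev' _ _ (Aincx h); have [l el] := ext h.
  by exists (l + k)%R; rewrite ek Ldeg_ext el mulrDl addrA.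
Qed.

Lemma Lstruct_iso_trans r G (A B C : Lstruct r G) : 0 < r ->
  Lstruct_iso A B -> Lstruct_iso B C -> Lstruct_iso A C.
Proof.
move=> r_gt0 /Lstruct_iso_shift[T [deg mu ev ext]].
case/Lstruct_iso_shift=> [U [deg' mu' ev' ext']].
apply: (Lstruct_shift_iso (T := off_ext (fun x => (T x + U x)%R))) => //=.
- by move=> v; rewrite deg.
- move=> v i j q e.
  have [k [p ek]] := int_split (Ldeg B (Avert v)) (i%:Z + T (Avert v))%R.
  rewrite -(mu _ _ _ _ ek); apply: (mu' (Avert v) k j (q - p)%R).
  have d (c : int) : (c * (Ldeg C (Avert v)).+1%:Z = c * (Ldeg B (Avert v)).+1%:Z)%R.
    by rewrite deg'.
  by rewrite !d in e *; lia.
- move=> h e he i _; have [k ek] := ev _ _ (Ainc he); have [l el] := ev' _ _ (Ainc he).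
  exists (l + k)%R; rewrite addrA ek addrAC el !Ldeg_edge -addrA -mulrDl.
  by rewrite addrA.
- move=> h i _; have [k ek] := ev _ _ (Aincx h); have [l el] := ev' _ _ (Aincx h).
  have [k' ek'] := ext h; have [l' el'] := ext' h.
  have arith (a b c u v x y : int) : (a + u = b + x -> b + v = c + y ->
    a = c + x + y - u - v)%R by lia.
  exists (k + l - k' - l')%R; rewrite (arith _ _ _ _ _ _ _ (ek i) (el _)).
  by rewrite !Ldeg_ext ek' el' !mulrBl mulrDl !addrA.
Qed.

(** * The isomorphism criterion in terms of integers *)

Definition position r G (A : Lstruct r G) (p : halfedge G -> nat) : Prop :=
  forall v i, p (val (Lmu A (Avert v) i)) = i :> nat.

(** By [Lev_inc], the position of [h] and the value there determine the whole lift of its map. *)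
Definition inner_value r G (A : Lstruct r G) (a : halfedge G -> int) : Prop :=
  forall (h : halfedge G) (e : gedge G) (he : h \in val e)
    (i : 'I_(Ldeg A (Avert (gsrc h))).+1),
  val (Lmu A (Avert (gsrc h)) i) = h -> Lev A (Ainc he) i = a h.

Definition outer_value r G (A : Lstruct r G) (a : halfedge G -> int) : Prop :=
  forall (h : external G) (i : 'I_(Ldeg A (Avert (gsrc (val h)))).+1),
  val (Lmu A (Avert (gsrc (val h))) i) = val h -> Lev A (Aincx h) i = a (val h).

Lemma is_gedge_set2 G (h : halfedge G) : ginv h != h -> is_gedge [set h; ginv h].
Proof. by move=> nh; apply/existsP; exists h; rewrite nh eqxx. Qed.

Definition gedge_of G (h : halfedge G) (nh : ginv h != h) : gedge G :=
  exist (fun E : {set halfedge G} => is_gedge E) _ (is_gedge_set2 nh).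

Lemma Lmu_surj r G (A : Lstruct r G) (h : halfedge G) :
  exists i : 'I_(Ldeg A (Avert (gsrc h))).+1, val (Lmu A (Avert (gsrc h)) i) = h.
Proof.
have [g _ Kg] := @Lmu_bij r G A (Avert (gsrc h)).
by exists (g (exist _ h (eqxx _))); rewrite Kg.
Qed.

Lemma inner_value_exists r G (A : Lstruct r G) : exists a, inner_value A a.
Proof.
suff /fin_all_exists[a aP] : forall h, exists a : int, forall (e : gedge G)
    (he : h \in val e) (i : 'I_(Ldeg A (Avert (gsrc h))).+1),
    val (Lmu A (Avert (gsrc h)) i) = h -> Lev A (Ainc he) i = a.
  by exists a => h; apply: aP.
move=> h; have [nh|nh] := eqVneq (ginv h) h.
  by exists 0%R => e he; have := gedge_ginv he; rewrite nh eqxx.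
pose e0 := gedge_of nh.
have he0 : h \in val e0 by rewrite set21.
have [i0 hi0] := Lmu_surj A h; exists (Lev A (Ainc he0) i0) => e he i hi.
have ee0 : e = e0.
  apply: val_inj; have /existsP[k /andP[_ /eqP eE]] := valP e.
  have hE := he; rewrite eE in hE; rewrite [LHS]eE /=.
  by case/set2P: hE => ->; rewrite ?ginvK // setUC.
subst e; have -> : i = i0.
  apply: (bij_inj (@Lmu_bij r G A (Avert (gsrc h)))).
  by apply: val_inj; rewrite /= hi hi0.
by rewrite (bool_irrelevance he he0).
Qed.

Lemma outer_value_exists r G (A : Lstruct r G) : exists a, outer_value A a.
Proof.
suff /fin_all_exists[a aP] : forall h, exists a : int,
    forall (x : external G) (i : 'I_(Ldeg A (Avert (gsrc (val x)))).+1), val x = h ->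
    val (Lmu A (Avert (gsrc (val x))) i) = val x -> Lev A (Aincx x) i = a.
  by exists a => h i; apply: aP.
move=> h; have [nh|nh] := boolP (ginv h == h); last first.
  by exists 0%R => -[x hx] i /= e; rewrite -e hx in nh.
pose x0 : external G := exist (fun h => ginv h == h) _ nh; have [i0 hi0] := Lmu_surj A h.
exists (Lev A (Aincx x0) i0) => x i ex hi; have {}ex : x = x0 by apply: val_inj.
subst x; congr Lev; congr Posz; congr nat_of_ord.
apply: (bij_inj (@Lmu_bij r G A (Avert (gsrc h)))).
by apply: val_inj; rewrite /= hi hi0.
Qed.

(** Each full turn at a vertex moves the value on the edge by 2, the period of [1]. Subtracting the
    conditions at the two half-edges of an edge removes its translation; an external half-edge has
    no translation to remove. *)
Lemma Lstruct_iso_values r G (A B : Lstruct r G) pA pB a b a' b' : 0 < r ->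
  position A pA -> position B pB -> inner_value A a -> inner_value B b ->
  outer_value A a' -> outer_value B b' ->
  Lstruct_iso A B <->
  (forall v, Ldeg A (Avert v) = Ldeg B (Avert v)) /\
  exists (t : gvertex G -> int) (q : halfedge G -> int),
  [/\ forall h, ((pA h)%:Z + t (gsrc h) =
                 (pB h)%:Z + q h * (Ldeg A (Avert (gsrc h))).+1%:Z)%R,
      forall h, ginv h != h -> exists k : int,
        (a h - a (ginv h) =
         b h + q h * 2 - (b (ginv h) + q (ginv h) * 2) + k * (r%:Z * 2))%R
    & forall h, ginv h = h -> exists k : int,
        (a' h = b' h + q h * 2 + k * (r%:Z * 2))%R].
Proof.
move=> r_gt0 posA posB aP bP aP' bP'; split.
  case/Lstruct_iso_shift=> T [deg mu ev ext]; split=> //.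
  exists (fun v => T (Avert v)).
  have corr h : exists (q : int), forall i : 'I_(Ldeg A (Avert (gsrc h))).+1,
      val (Lmu A (Avert (gsrc h)) i) = h ->
      exists j : 'I_(Ldeg B (Avert (gsrc h))).+1,
      val (Lmu B (Avert (gsrc h)) j) = h /\
      (i%:Z + T (Avert (gsrc h)) = j%:Z + q * (Ldeg B (Avert (gsrc h))).+1%:Z)%R.
    have [i hi] := Lmu_surj A h.
    have [j [q ij]] := int_split (Ldeg B (Avert (gsrc h))) (i%:Z + T (Avert (gsrc h)))%R.
    exists q => i' hi'; exists j; rewrite (mu _ _ _ _ ij); split=> //.
    by rewrite -ij -(posA _ i) -(posA _ i') hi hi'.
  have [q qP] := fin_all_exists corr; exists q; split=> h.
  - have [i hi] := Lmu_surj A h; have [j [hj ij]] := qP h i hi.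
    have -> : pA h = i by rewrite -(posA _ i) hi.
    have -> : pB h = j by rewrite -(posB _ j) hj.
    by rewrite ij; congr (_ + _ * _)%R; rewrite deg.
  - move=> nh; pose e := gedge_of nh.
    have he : h \in val e by rewrite set21.
    have he' : ginv h \in val e by rewrite set22.
    have val1 k (hk : k \in val e) : exists l : int,
        (a k + T (Aedge e) = b k + q k * 2 + l * (r%:Z * 2))%R.
      have [i hi] := Lmu_surj A k; have [j [hj ij]] := qP k i hi.
      have [l el] := ev _ _ (Ainc hk); exists l; have := el i.
      rewrite (aP _ _ hk _ hi) ij /Lev wev_period -/(Ldeg B (Aedge e)).
      by rewrite -/(Lev B (Ainc hk) j) (bP _ _ hk _ hj) Ldeg_edge.
    have [l el] := val1 _ he; have [l' el'] := val1 _ he'; exists (l - l')%R.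
    by lia.
  - move=> nh; have [x xh] : exists x : external G, val x = h.
      by rewrite -nh; exists (exist (fun h => ginv h == h) h (introT eqP nh)).
    subst h; have [i hi] := Lmu_surj A (val x); have [j [hj ij]] := qP _ i hi.
    have [l el] := ev _ _ (Aincx x); have [l' el'] := ext x; exists (l - l')%R.
    have := el i; rewrite (aP' _ _ hi) ij /Lev wev_period -/(Ldeg B (Aext x)).
    by rewrite -/(Lev B (Aincx x) j) (bP' _ _ hj) Ldeg_ext el'; lia.
case=> deg [t [q [qP inP exP]]].
have gedge_pick (e : gedge G) : exists h, h \in val e.
  by case: e => E /= /existsP[h /andP[_ /eqP->]]; exists h; rewrite set21.
(* One half-edge dictates the translation of its edge; the condition on differences makes the other
   one agree modulo [2r]. *)
pose u e := let h := xchoose (gedge_pick e) in (b h + q h * 2 - a h)%R.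
have corr v (i : 'I_(Ldeg A (Avert v)).+1) (j : 'I_(Ldeg B (Avert v)).+1) (s : int) :
    (i%:Z + t v = j%:Z + s * (Ldeg B (Avert v)).+1%:Z)%R ->
    Lmu B (Avert v) j = Lmu A (Avert v) i /\ s = q (val (Lmu A (Avert v) i)).
  move=> ij; set h := Lmu A (Avert v) i.
  have [g _ Kg] := @Lmu_bij r G B (Avert v).
  have := qP (val h); rewrite (eqP (valP h)) posA ij.
  have -> : pB (val h) = g h by rewrite -(posB _ (g h)) Kg.
  have -> : (q (val h) * (Ldeg A (Avert v)).+1%:Z =
             q (val h) * (Ldeg B (Avert v)).+1%:Z)%R by rewrite deg.
  by case/int_split_uniq=> -> ->; rewrite Kg.
apply: (Lstruct_shift_iso (T := fun x => match x with
  | Avert v => t v | Aedge e => u e | Aext _ => 0%R end)) => //.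
- by move=> v i j s ij; have [] := corr v i j s ij.
- move=> h e he i hi.
  have [j [s ij]] := int_split (Ldeg B (Avert (gsrc h))) (i%:Z + t (gsrc h))%R.
  have [muij es] := corr _ _ _ _ ij; rewrite hi in es.
  rewrite (aP _ _ he _ hi) ij /Lev wev_period -/(Ldeg B (Aedge e)).
  rewrite -/(Lev B (Ainc he) j) (bP _ _ he) ?muij // Ldeg_edge es /u.
  have := xchooseP (gedge_pick e); move: (xchoose _) => k ke.
  have [->|->] := gedge_mem_cases he ke; first by exists 0%R; lia.
  by have [l el] := inP h (gedge_ginv he); exists l; lia.
- move=> h i hi.
  have [j [s ij]] := int_split (Ldeg B (Avert (gsrc (val h)))) (i%:Z + t (gsrc (val h)))%R.
  have [muij es] := corr _ _ _ _ ij; rewrite hi in es.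
  rewrite (aP' _ _ hi) ij /Lev wev_period -/(Ldeg B (Aext h)).
  rewrite -/(Lev B (Aincx h) j) (bP' _ _) ?muij // Ldeg_ext es.
  by have [l el] := exP (val h) (eqP (valP h)); exists l; rewrite el; lia.
Qed.

(** * Markings up to fixed moves *)

Lemma Zmod_add r (x y : Zmod r) : 0 < r ->
  exists k : int, ((x + y)%R%:Z = x%:Z + y%:Z + k * r%:Z)%R.
Proof.
case: r x y => // n; rewrite -[n.+1.-1.+1]/n.+1 => x y _.
exists (- ((x + y) %/ n.+1)%N%:Z)%R.
have -> : (x + y)%R = (x + y) %% n.+1 :> nat by [].
by move: (divn_eq (x + y) n.+1); move: (_ %/ _) (_ %% _) => a b; lia.
Qed.

Lemma Zmod_opp r (x : Zmod r) : 0 < r ->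
  exists k : int, ((- x)%R%:Z = - x%:Z + k * r%:Z)%R.
Proof.
move=> /(Zmod_add x (- x)%R)[k]; rewrite subrr -[LHS]/(0%Z) => e.
by exists (- k)%R; lia.
Qed.

Lemma Zmod_sub r (x y : Zmod r) : 0 < r ->
  exists k : int, ((x - y)%R%:Z = x%:Z - y%:Z + k * r%:Z)%R.
Proof.
move=> r_gt0; have [k ek] := Zmod_add x (- y)%R r_gt0.
by have [l el] := Zmod_opp y r_gt0; exists (k + l)%R; rewrite ek el; lia.
Qed.

Lemma Zmod_inZp r (x : nat) : 0 < r ->
  exists k : int, ((inZp x : Zmod r)%:Z = x%:Z + k * r%:Z)%R.
Proof.
case: r => // n _; exists (- (x %/ n.+1)%N%:Z)%R.
rewrite -[n.+1.-1.+1]/n.+1.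
have -> : (inZp x : 'I_n.+1) = x %% n.+1 :> nat by [].
by move: (divn_eq x n.+1); move: (_ %/ _) (_ %% _) => a b; lia.
Qed.

(* The label of [e] after reorienting it in the direction [b]. *)
Definition olab r K (m : marking r K) (e : Kbar1 K) (b : bool) : int :=
  (if b == ori m e then (lab m e)%:Z else - (lab m e)%:Z - 1)%R.

(** The label the edge would carry if oriented with the face of [h] on its left. *)
Definition slab r K (m : marking r K) (h : side K) : int :=
  olab m (side_edge h) (val h).2.

Lemma olab_neg r K (m : marking r K) e b :
  olab m e (~~ b) = (- 1 - olab m e b)%R.
Proof. by rewrite /olab; case: b (ori m e) => [] [] /=; lia. Qed.

(** The default 0 is the contribution of the outer direction of a boundary edge, where there is no
    face to turn. *)
Definition at_side K (q : side K -> int) (d : oedge K) : int :=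
  if insub d is Some h then q h else 0%R.

Lemma at_side_val K (q : side K -> int) (h : side K) : at_side q (val h) = q h.
Proof. by rewrite /at_side valK. Qed.

Lemma at_side_not K (q : side K -> int) d : ~~ is_side d -> at_side q d = 0%R.
Proof. by move=> nd; rewrite /at_side insubN. Qed.

Definition side_index r K (m : marking r K) (h : side K) : nat :=
  index h (face_sides m (side_face h)).

Lemma perm_face_sides r r' K (m : marking r K) (m' : marking r' K) f :
  perm_eq (face_sides m f) (face_sides m' f).
Proof.
apply: uniq_perm; rewrite ?uniq_face_sides // => h.
by rewrite !mem_face_sides.
Qed.

Lemma size_face_sides_eq r r' K (m : marking r K) (m' : marking r' K) f :
  size (face_sides m f) = size (face_sides m' f).
Proof. exact/perm_size/perm_face_sides. Qed.

(* [m'] is obtained from [m] by moving the mark of each face [f] by [- t f] sides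
   counterclockwise (deck transformations are full turns), and [- q h] counts
   with sign how often the mark passes the side [h]. *)
Definition turned_by r K (m m' : marking r K) (t : K2 K -> int)
    (q : side K -> int) : Prop :=
  (forall h, ((side_index m h)%:Z + t (side_face h) =
     (side_index m' h)%:Z + q h * (size (face_sides m (side_face h)))%:Z)%R) /\
  (forall e, exists k : int, (olab m' e true =
     olab m e true + at_side q (val e, true) - at_side q (val e, false)
     + k * r%:Z)%R).

Definition turned r K (m m' : marking r K) : Prop :=
  exists t q, turned_by m m' t q.

Lemma turned_refl r K (m : marking r K) : turned m m.
Proof.
exists (fun=> 0%R), (fun=> 0%R); split=> [h|e]; first by lia.
by exists 0%R; rewrite /at_side; case: insub => [?|]; case: insub => [?|]; lia.
Qed.

Lemma at_sideN K (q : side K -> int) d :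
  at_side (fun h => - q h)%R d = (- at_side q d)%R.
Proof. by rewrite /at_side; case: insub => [?|]; lia. Qed.

Lemma at_sideD K (q q' : side K -> int) d :
  at_side (fun h => q h + q' h)%R d = (at_side q d + at_side q' d)%R.
Proof. by rewrite /at_side; case: insub => [?|]; lia. Qed.

Lemma turned_sym r K (m m' : marking r K) : turned m m' -> turned m' m.
Proof.
case=> t [q [tq lq]]; exists (fun f => - t f)%R, (fun h => - q h)%R.
split=> [h|e]; first by rewrite (size_face_sides_eq m' m); have := tq h; lia.
by have [k ek] := lq e; exists (- k)%R; rewrite !at_sideN; lia.
Qed.

Lemma turned_trans r K (m m' m'' : marking r K) :
  turned m m' -> turned m' m'' -> turned m m''.
Proof.
case=> t [q [tq lq]] [t' [q' [tq' lq']]].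
exists (fun f => t f + t' f)%R, (fun h => q h + q' h)%R.
split=> [h|e].
  by have := tq h; have := tq' h; rewrite (size_face_sides_eq m' m); lia.
have [k ek] := lq e; have [k' ek'] := lq' e; exists (k + k')%R.
by rewrite !at_sideD; lia.
Qed.

Lemma at_side0 K d : at_side (fun _ : side K => 0%R) d = 0%R.
Proof. by rewrite /at_side; case: insub. Qed.

Lemma lab_dec r (x : Zmod r) : 0 < r ->
  exists k : int, ((x - inZp 1)%R%:Z = x%:Z - 1 + k * r%:Z)%R.
Proof.
move=> r_gt0; have [k1 e1] := Zmod_inZp 1 r_gt0.
have [k2 e2] := Zmod_sub x (inZp 1) r_gt0.
by exists (k2 - k1)%R; rewrite e2 e1; lia.
Qed.

Lemma lab_inc r (x : Zmod r) : 0 < r ->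
  exists k : int, ((x + inZp 1)%R%:Z = x%:Z + 1 + k * r%:Z)%R.
Proof.
move=> r_gt0; have [k1 e1] := Zmod_inZp 1 r_gt0.
have [k2 e2] := Zmod_add x (inZp 1) r_gt0.
by exists (k2 + k1)%R; rewrite e2 e1; lia.
Qed.

Lemma lab_rev r (x : Zmod r) : 0 < r ->
  exists k : int, ((- x - inZp 1)%R%:Z = - x%:Z - 1 + k * r%:Z)%R.
Proof.
move=> r_gt0; have [k1 e1] := Zmod_opp x r_gt0.
have [k2 e2] := lab_dec (- x)%R r_gt0.
by exists (k1 + k2)%R; rewrite e2 e1; lia.
Qed.

(** * Fixed moves are turns *)

Lemma turned_rev r K (m : marking r K) e : 0 < r -> turned m (rev_edge e m).
Proof.
move=> r_gt0; exists (fun=> 0%R), (fun=> 0%R); split=> [h|e'].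
  by rewrite mul0r; congr (_ + _)%R.
rewrite !at_side0 /olab !ffunE addr0 subr0; have [->|ne] := eqVneq e' e; last first.
  by exists 0%R; rewrite mul0r addr0.
have [k ek] := lab_rev (lab m e) r_gt0.
by rewrite ek; case: (ori m e); [exists (- k)%R|exists k] => /=; lia.
Qed.

Lemma turned_deck r K (m : marking r K) f k : 0 < r -> turned m (deck f k m).
Proof.
move=> r_gt0.
(* These are [k] full turns of [f]: positions return, and every side of [f] passes the seam [k]
   times. *)
exists (fun f' => if f' == f then k%:Z * (size (face_sides m f))%:Z else 0)%R.
exists (fun h => if side_face h == f then k%:Z else 0)%R.
split=> [h|e]; first by case: eqP => [->|_]; rewrite ?mul0r.
set q := fun h : side K => _.
have qE b : at_side q (val e, b) = (if is_face f (left (val e, b)) then k%:Z else 0)%R.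
  have [sd|nsd] := boolP (is_side (val e, b)).
    pose h : side K := exist (fun d => is_side d) _ sd.
    by rewrite -[(val e, b)]/(val h) at_side_val side_faceP.
  rewrite at_side_not //; move: nsd; rewrite /is_side /= (valP e) andbT negbK.
  by case: (left _).
rewrite !qE /olab !ffunE.
set x := if is_face f (left (val e, ori m e)) then k else 0%R.
set y := if is_face f (left (val e, ~~ ori m e)) then k else 0%R.
have [k1 e1] := Zmod_add (lab m e) x r_gt0.
have [k2 e2] := Zmod_sub (lab m e + x)%R y r_gt0.
rewrite e2 e1; have c (a : bool) : (((if a then k else 0%R) : nat)%:Z = if a then k%:Z else 0)%R.
  by case: a.
rewrite /x /y !c; case: (ori m e) => /=; [exists (k1 + k2)%R|exists (- k1 - k2)%R]; lia.
Qed.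

Lemma orbit_ccw K (d : oedge K) :
  orbit ccw (ccw d) = rcons (behead (orbit ccw d)) d.
Proof.
have oE : order ccw (ccw d) = order ccw d.
  exact/order_id_cycle/cycle_orbit/ccw_inj.
have := iter_order (@ccw_inj K) d.
rewrite /orbit oE -orderSpred; move: (order ccw d).-1 => n.
by rewrite trajectSr /= -iterSr /= => ->.
Qed.

Lemma turned_mark r K (m : marking r K) f : 0 < r -> turned m (move_mark f m).
Proof.
move=> r_gt0; pose d := mark m f; have df : left d = inl f := left_mark m f.
have sE : face_sides (move_mark f m) f =
    pmap insub (rcons (behead (orbit ccw d)) d).
  by rewrite /face_sides /= ffunE eqxx /sides_from orbit_ccw.
have oE : orbit ccw d = d :: behead (orbit ccw d).
  by rewrite /orbit -orderSpred.
have otherE f' : f' != f -> face_sides (move_mark f m) f' = face_sides m f'.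
  by move=> ne; rewrite /face_sides /= ffunE (negbTE ne).
have [sd|nsd] := boolP (is_side d); last first.
  (* The mark leaves an edge of the free boundary, which is not listed among the sides, so neither
     positions nor labels change. *)
  have same f' : face_sides (move_mark f m) f' = face_sides m f'.
    have [->|/otherE//] := eqVneq f' f; rewrite sE /face_sides /sides_from -/d oE.
    by rewrite -cats1 pmap_cat /= insubN // cats0.
  exists (fun=> 0%R), (fun=> 0%R); split=> [h|e].
    by rewrite /side_index same mul0r.
  exists 0%R; rewrite /olab !ffunE !at_side0 -/d; case: (val e =P d.1) => [ed|_];
    last by rewrite mul0r subr0 !addr0.
  by move: nsd; rewrite /is_side df /= -ed (valP e).
pose h0 : side K := exist (fun d => is_side d) _ sd.
have h0f : side_face h0 = f by have := side_faceP h0; rewrite /= df => -[].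
have sE0 : face_sides m f = h0 :: pmap insub (behead (orbit ccw d)).
  by rewrite /face_sides /sides_from -/d oE /= insubT.
have sE1 : face_sides (move_mark f m) f =
    rcons (pmap insub (behead (orbit ccw d))) h0.
  by rewrite sE -!cats1 pmap_cat /= insubT.
(* The list of sides rotates by one: the old marked side [h0] goes from first to last place, so it
   alone passes the seam, and all other indices of [f] drop by one. *)
exists (fun f' => if f' == f then -1 else 0)%R.
exists (fun h => if h == h0 then -1 else 0)%R; split=> [h|e].
  rewrite /side_index; have [hf|nhf] := eqVneq (side_face h) f; last first.
    rewrite otherE //; case: eqP => [e|_]; last by rewrite mul0r.
    by rewrite e h0f eqxx in nhf.
  have := uniq_face_sides m f; have hs : h \in face_sides m f.
    by rewrite mem_face_sides hf.
  rewrite hf sE1; move: hs; rewrite sE0; move: (pmap _ _) => s /=.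
  rewrite inE -cats1 index_cat /= (eq_sym h0 h).
  have [->|nh] /= := eqVneq h h0; first by move=> _ /andP[/negbTE-> _]; lia.
  by move=> -> _; lia.
have qE b : at_side (fun h : side K => if h == h0 then -1 else 0)%R (val e, b) =
    (if d == (val e, b) then -1 else 0)%R.
  have [sb|nsb] := boolP (is_side (val e, b)).
    pose h : side K := exist (fun d => is_side d) _ sb.
    by rewrite -[(val e, b)]/(val h) at_side_val -val_eqE /= eq_sym.
  rewrite at_side_not //; case: eqP => // ed; rewrite -ed sd in nsb; by [].
rewrite !qE /olab !ffunE -/d.
have [k1 e1] := lab_dec (lab m e) r_gt0; have [k2 e2] := lab_inc (lab m e) r_gt0.
have dE b : (d == (val e, b)) = (val e == d.1) && (d.2 == b).
  by rewrite -pair_eqE /= eq_sym.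
rewrite !dE; case: (val e == d.1); last by exists 0%R; rewrite mul0r subr0 !addr0.
case: d.2 (ori m e) => [] []; rewrite [_ == _]/= ?e1 ?e2 /=.
- by exists k1; lia.
- by exists (- k2)%R; lia.
- by exists k2; lia.
- by exists (- k1)%R; lia.
Qed.

Lemma turned_sim r K (m m' : marking r K) : 0 < r -> sim_fix m m' -> turned m m'.
Proof.
move=> r_gt0; elim=> {m m'} [m _ []|m|m m' _|m m' m'' _ tm _].
- by move=> e; apply: turned_rev.
- by move=> f; apply: turned_mark.
- by move=> f k; apply: turned_deck.
- exact: turned_refl.
- exact: turned_sym.
- exact: turned_trans.
Qed.

Lemma turned_lab r K (m m' : marking r K) t q : turned_by m m' t q ->
  forall e b, exists k : int, (olab m' e b =
    olab m e b + at_side q (val e, b) - at_side q (val e, ~~ b) + k * r%:Z)%R.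
Proof.
move=> [_ lq] e b; have [k ek] := lq e; case: b; first by exists k.
exists (- k)%R; have := olab_neg m' e true; have := olab_neg m e true => /= -> ->.
have arith (a x y z : int) : (- 1 - (a + x - y + z) = - 1 - a + y - x - z)%R by lia.
by rewrite ek mulNr; exact: arith.
Qed.

(** * Turns are realized by fixed moves *)

Lemma marking_eq r K (m m' : marking r K) :
  ori m = ori m' -> lab m = lab m' -> mark m = mark m' -> m = m'.
Proof.
case: m m' => [o l k lk] [o' l' k' lk'] /= eo el ek; subst o' l' k'.
by congr Marking; apply: proof_irrelevance.
Qed.

Lemma sim_fix_trans r K (m m' m'' : marking r K) :
  sim_fix m m' -> sim_fix m' m'' -> sim_fix m m''.
Proof. exact: rst_trans. Qed.

Lemma sim_move_marks r K (m m' : marking r K) (s : seq (K2 K)) :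
  exists m1, sim_fix m m1 /\ {in s, forall f, mark m1 f = mark m' f}.
Proof.
elim: s => [|f s [m1 [sm1 eqm1]]]; first by exists m; split=> //; apply: rst_refl.
suff [m2 [sm2 m2f m2o]] : exists m2, [/\ sim_fix m1 m2, mark m2 f = mark m' f &
    forall f', f' != f -> mark m2 f' = mark m1 f'].
  exists m2; split; first exact: sim_fix_trans sm1 sm2.
  move=> f'; rewrite inE; have [->|ne] /= := eqVneq f' f; first by [].
  by rewrite m2o //; apply: eqm1.
have /iter_findex <- : fconnect ccw (mark m1 f) (mark m' f).
  by apply: face_cycle; apply: left_mark.
elim: (findex _ _ _) => [|n [m2 [sm2 m2f m2o]]].
  by exists m1; split=> //; apply: rst_refl.
exists (move_mark f m2); split.
- by apply: sim_fix_trans sm2 _; apply/rst_step/FixMark.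
- by rewrite /= ffunE eqxx m2f.
- by move=> f' ne; rewrite /= ffunE (negbTE ne) m2o.
Qed.

Lemma sim_orient r K (m m' : marking r K) (s : seq (Kbar1 K)) :
  exists m1, [/\ sim_fix m m1, mark m1 = mark m &
                 {in s, forall e, ori m1 e = ori m' e}].
Proof.
elim: s => [|e s [m1 [sm1 mkm1 eqm1]]].
  by exists m; split=> //; apply: rst_refl.
have [eo|no] := eqVneq (ori m1 e) (ori m' e).
  by exists m1; split=> // e'; rewrite inE => /predU1P[->//|]; apply: eqm1.
exists (rev_edge e m1); split=> //.
  by apply: sim_fix_trans sm1 _; apply/rst_step/FixRev.
move=> e'; rewrite inE /= ffunE; have [->|_] /= := eqVneq e' e; last exact: eqm1.
by case: (ori m1 e) (ori m' e) no => [] [].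
Qed.

Lemma sim_decks r K (m : marking r K) (k : K2 K -> Zmod r) (s : seq (K2 K)) :
  exists m1, [/\ sim_fix m m1, mark m1 = mark m, ori m1 = ori m &
    forall e, lab m1 e = (lab m e
      + \sum_(f <- s) (if is_face f (left (val e, ori m e)) then k f else 0)
      - \sum_(f <- s) (if is_face f (left (val e, ~~ ori m e)) then k f else 0))%R].
Proof.
elim: s => [|f s [m1 [sm1 mkm1 om1 lm1]]].
  exists m; split=> // [|e]; first exact: rst_refl.
  by rewrite !big_nil subr0 addr0.
exists (deck f (k f) m1); split=> //.
  by apply: sim_fix_trans sm1 _; apply/rst_step/FixDeck.
move=> e; rewrite !big_cons ffunE lm1 om1; set x := if _ then _ else _.
set y := if _ then _ else _; set X := bigop _ _ _; set Y := bigop _ _ _.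
by rewrite opprD !addrA -!(addrAC _ (- Y)%R) -!(addrAC _ x).
Qed.

Lemma sum_is_face (V : zmodType) K (k : K2 K -> V) (x : K2 K + bkind) :
  (\sum_(f <- enum (K2 K)) (if is_face f x then k f else 0) =
   if x is inl g then k g else 0)%R.
Proof.
rewrite big_enum; case: x => [g|b] /=; last by rewrite big1.
by rewrite -big_mkcond (big_pred1 g) // => f; rewrite eq_sym.
Qed.

Lemma Zmod_of_int r (x : int) : 0 < r -> exists (y : Zmod r) (j : int),
  (y%:Z = x + j * r%:Z)%R.
Proof.
case: r => // n _; have [y [q ->]] := int_split n x.
by exists y, (- q)%R; rewrite mulNr addrK.
Qed.

Lemma Zmod_eq r (x y : Zmod r) (j : int) : 0 < r ->
  (x%:Z = y%:Z + j * r%:Z)%R -> x = y.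
Proof.
case: r x y => // n x y _ e.
by have [|-> _] := @int_split_uniq n x y 0 j; first by rewrite mul0r addr0.
Qed.

(** Mark moves and reversals first make marks and orientations equal. What is left fixes all
    positions, so each [t f] is a whole number of turns and [q] is constant on the sides of [f]:
    exactly a deck transformation of every face. *)
Lemma sim_turned r K (wK : whole K) (m m' : marking r K) : 0 < r ->
  turned m m' -> sim_fix m m'.
Proof.
move=> r_gt0 tmm'.
have [m1 [sm1 mk1]] := sim_move_marks m m' (enum (K2 K)).
have [m2 [sm2 mk2 or2]] := sim_orient m1 m' (enum {: Kbar1 K}).
have emk : mark m2 = mark m'.
  by apply/ffunP => f; rewrite mk2 mk1 // mem_enum.
have eor : ori m2 = ori m' by apply/ffunP => e; rewrite or2 // mem_enum.
have sm2' := sim_fix_trans sm1 sm2; apply: (sim_fix_trans sm2').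
have [t [q tq]] := turned_trans (turned_sym (turned_sim r_gt0 sm2')) tmm'.
have qt h : (t (side_face h) = q h * (size (face_sides m2 (side_face h)))%:Z)%R.
  by have := tq.1 h; rewrite /side_index /face_sides emk => /addrI.
have /fin_all_exists[k kP] f : exists y : Zmod r, forall h, side_face h = f ->
    exists j : int, (y%:Z = q h + j * r%:Z)%R.
  have [h0 h0f] := side_face_surj wK f.
  have [y [j ej]] := Zmod_of_int (q h0) r_gt0; exists y => h hf; exists j.
  rewrite ej; congr (_ + _)%R; have := qt h; rewrite hf -h0f qt.
  by apply: mulIf; rewrite -(size_face_sides wK).
have [m3 [sm3 mk3 or3 lab3]] := sim_decks m2 k (enum (K2 K)).
suff -> : m' = m3 by [].
apply: marking_eq; rewrite ?or3 ?mk3 //; apply/ffunP => e.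
have [j ej] := turned_lab tq e (ori m2 e).
pose kl d : Zmod r := if left d is inl g then k g else 0%R.
have kq b : exists i : int,
    ((kl (val e, b))%:Z = at_side q (val e, b) + i * r%:Z)%R.
  rewrite /kl.
  have [sd|nsd] := boolP (is_side (val e, b)).
    pose h : side K := exist (fun d => is_side d) _ sd.
    rewrite -[(val e, b)]/(val h) side_faceP at_side_val; exact: kP.
  rewrite at_side_not //; move: nsd; rewrite /is_side /= (valP e) andbT negbK.
  by case: (left _) => // _ _; exists 0%R.
have [i1 e1] := kq (ori m2 e); have [i2 e2] := kq (~~ ori m2 e).
have le : lab m3 e = (lab m2 e + kl (val e, ori m2 e) - kl (val e, ~~ ori m2 e))%R.
  by rewrite lab3 !sum_is_face.
have [i3 e3] := Zmod_add (lab m2 e) (kl (val e, ori m2 e)) r_gt0.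
have := Zmod_sub (lab m2 e + kl (val e, ori m2 e))%R
  (kl (val e, ~~ ori m2 e)) r_gt0.
rewrite -le => -[i4 e4]; rewrite e3 e1 e2 in e4.
move: ej; rewrite /olab -eor eqxx => ej.
apply: (Zmod_eq (j := (j - i1 + i2 - i3 - i4)%R) r_gt0).
have arith (a b c R x y z u v : int) : (a + b - c + x * R =
    a + (b + y * R) + u * R - (c + z * R) + v * R + (x - y + z - u - v) * R)%R.
  by lia.
by rewrite ej e4; apply: arith.
Qed.

(** * Comparing induced structures *)

Lemma wev_comp_tauZ n m (w : word n m) (z x : int) :
  wev (wcomp w (tauZ n z)) x = wev w (x - z)%R.
Proof. by rewrite -[LHS]/(wev w (wev (tauZ n z) x)) wev_tauZ. Qed.

Lemma wev_psi_first n k (c : int) :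
  wev (psi_first n k) (k%:Z + c * n.+1%:Z)%R = (c * 2)%R.
Proof.
rewrite wev_period -[X in (X + _)%R]/(two_step n (wev (tauZ n (Posz k)) (Posz k))).
by rewrite wev_tauZ subrr (two_stepE (@ord0 n)) add0r.
Qed.

Lemma wev_psi_last n k (c : int) :
  wev (psi_last n k) (k%:Z + c * n.+1%:Z)%R = (1 + c * 2)%R.
Proof.
rewrite wev_period.
rewrite -[X in (X + _)%R]/(dmap_lift (phi_last n) (wev (tauZ n (Posz k - Posz n)%R) (Posz k))).
rewrite wev_tauZ subKr -[Posz n]/(Posz (@ord_max n)).
by rewrite dmap_liftE0 /= eqxx inordK.
Qed.

(** At the [k]-th position [psi_first] lifts to 0 and [psi_last] to 1; the power of [tau] advances
    the argument by [s] turns and so the value by [2s]. *)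
Definition induced_inner_value r K (m : marking r K) (h : side K) : int :=
  (if on_left (normalize m) h then 0
   else 1 + (lab (normalize m) (side_edge h))%:Z * 2)%R.

Definition induced_outer_value r K (m : marking r K) (h : side K) : int :=
  (if ingoing_side h then 1 + (lab (normalize m) (side_edge h))%:Z * 2
   else - ((lab (normalize m) (side_edge h))%:Z + 1) * 2)%R.

Lemma wev_induced_inner r K (m : marking r K) h :
  wev (induced_inner m h) (side_index m h) = induced_inner_value m h.
Proof.
rewrite /induced_inner /induced_inner_value -/(side_index m h).
case: ifP => _.
  by have := wev_psi_first (size (face_sides m (side_face h))).-1 (side_index m h) 0;
    rewrite !mul0r addr0.
by rewrite wev_comp_tauZ opprK PoszM mulrC; exact: wev_psi_last.
Qed.

Lemma wev_induced_outer r K (m : marking r K) h :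
  wev (induced_outer m h) (side_index m h) = induced_outer_value m h.
Proof.
rewrite /induced_outer /induced_outer_value -/(side_index m h).
case: ifP => _; rewrite wev_comp_tauZ PoszM mulrC.
  by rewrite opprK wev_psi_last.
by rewrite -mulNr wev_psi_first; congr (_ * _)%R; lia.
Qed.

Lemma position_induced r K (wK : whole K) (m : marking r K) :
  position (induced wK m) (side_index m).
Proof.
move=> f i; set h := val _; have hf : side_face h = f by apply/eqP/nth_face_sides.
rewrite /side_index hf; apply/esym/eqP; rewrite -(tnth_face_sides wK) //.
Qed.

Lemma inner_value_induced r K (wK : whole K) (m : marking r K) :
  inner_value (induced wK m) (induced_inner_value m).
Proof.
move=> h e he i hi; rewrite -wev_induced_inner.
have -> : side_index m h = i by rewrite -(position_induced i) hi.
by [].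
Qed.

Lemma outer_value_induced r K (wK : whole K) (m : marking r K) :
  outer_value (induced wK m) (induced_outer_value m).
Proof.
move=> h i hi; rewrite -wev_induced_outer.
have -> : side_index m (val h) = i by rewrite -(position_induced i) hi.
by [].
Qed.

Lemma slab_normalize r K (m : marking r K) h : 0 < r ->
  exists k : int, (slab (normalize m) h = slab m h + k * r%:Z)%R.
Proof.
move=> r_gt0; rewrite /slab /olab !ffunE; case: misoriented; last first.
  by exists 0%R; rewrite mul0r addr0.
have [k ek] := lab_rev (lab m (side_edge h)) r_gt0; rewrite ek.
by case: (val h).2 (ori m _) => [] []; [exists (- k)%R|exists k|exists k|exists (- k)%R];
  rewrite /=; lia.
Qed.

Lemma slab_inv r K (m : marking r K) (h : side K) : is_side (Defs.rev (val h)) ->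
  slab m (side_inv h) = (- 1 - slab m h)%R.
Proof.
move=> sr; rewrite /slab -olab_neg side_inv_val sr.
by congr olab; apply: val_inj; rewrite /= side_inv_val sr.
Qed.

(** From the left the difference is [1 + 2s]; from the right it changes sign, which is again
    [1 + 2(-1 - s)]. *)
Lemma inner_value_diff r K (m : marking r K) (h : side K) : 0 < r ->
  is_side (Defs.rev (val h)) -> exists k : int,
  (induced_inner_value m (side_inv h) - induced_inner_value m h =
   1 + slab m h * 2 + k * (r%:Z * 2))%R.
Proof.
move=> r_gt0 sr; have [k ek] := slab_normalize m h r_gt0; exists k.
have iv h' : induced_inner_value m h' =
    (if on_left (normalize m) h' then 0 else - 1 - slab (normalize m) h' * 2)%R.
  rewrite /induced_inner_value /slab /olab -/(on_left _ _).
  by case: ifP => // _; lia.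
rewrite !iv on_left_inv // slab_inv // ek.
by case: on_left => /=; lia.
Qed.

(** An ingoing edge is normalized to have the face on its right, so its side sees [-1 - s] and the
    value is [1 + 2s = -1 - 2(-1 - s)]. An outgoing one sees [s], with value
    [-2(s + 1) = -2 - 2s]. *)
Definition outer_shift K (h : side K) : int := (if ingoing_side h then - 1 else - 2)%R.

Lemma outer_value_slab r K (m : marking r K) (h : side K) : 0 < r ->
  ~~ is_side (Defs.rev (val h)) -> exists k : int,
  (induced_outer_value m h = outer_shift h - slab m h * 2 + k * (r%:Z * 2))%R.
Proof.
move=> r_gt0 nsr; have [k ek] := slab_normalize m h r_gt0; exists (- k)%R.
have -> : (outer_shift h - slab m h * 2 + - k * (r%:Z * 2) =
   outer_shift h - slab (normalize m) h * 2)%R by rewrite ek; lia.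
(* The reverse direction is not a side, so the edge lies on the parametrized boundary and
   [normalize] orients it according to its kind. *)
have ol : on_left (normalize m) h = ~~ ingoing_side h.
  move: nsr; rewrite /is_side /= (proj2 (andP (valP h))) andbT negbK.
  have := side_faceP h; have := proj2 (andP (valP h)).
  rewrite /on_left /ingoing_side ffunE /misoriented /free_edge /=.
  case: (val h) (ori m _) => e b o /=.
  by case: b o => [] [] /=; rewrite /Defs.rev /=;
    case: (left (e, true)) => [?|[]]; case: (left (e, false)) => [?|[]].
rewrite /induced_outer_value /slab /olab -/(on_left _ _) ol /outer_shift.
by case: ingoing_side => /=; lia.
Qed.

Lemma side_inv_neq K (h : side K) : (side_inv h != h) = is_side (Defs.rev (val h)).
Proof.
rewrite -(inj_eq val_inj) side_inv_val; case: ifP; last by rewrite eqxx.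
by case: (val h) => e [] _; rewrite -pair_eqE /= andbF.
Qed.

Lemma at_side_rev K (q : side K -> int) (h : side K) :
  at_side q (Defs.rev (val h)) = (if side_inv h == h then 0 else q (side_inv h))%R.
Proof.
rewrite -[_ == h]negbK side_inv_neq; case sr: (is_side _);
  last by rewrite at_side_not ?sr.
have -> : Defs.rev (val h) = val (side_inv h) by rewrite side_inv_val sr.
by rewrite at_side_val.
Qed.

Lemma ex_side K (e : Kbar1 K) : exists h : side K, (val h).1 = val e.
Proof.
suff [b sb] : exists b, is_side (val e, b) by exists (exist (fun d => is_side d) _ sb).
have [o|no] := boolP (outside (left (val e, true))); [exists false|exists true].
  by rewrite /is_side (valP e) andbT; apply: (edge_face o).
by rewrite /is_side no (valP e).
Qed.

Definition slab_related r K (m m' : marking r K) (q : side K -> int) : Prop :=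
  forall h, exists k : int, (slab m' h = slab m h + q h
    - (if side_inv h == h then 0 else q (side_inv h)) + k * r%:Z)%R.

(** Passes from one label condition per edge, in its reference direction, to one per side, the form
    in which the isomorphism criterion delivers it. Opposite sides give equivalent conditions, since
    [s -> -1 - s] negates label differences. *)
Lemma turned_slab r K (m m' : marking r K) t q :
  turned_by m m' t q <->
  (forall h, ((side_index m h)%:Z + t (side_face h) =
     (side_index m' h)%:Z + q h * (size (face_sides m (side_face h)))%:Z)%R) /\
  slab_related m m' q.
Proof.
have edgeE (h : side K) b : (val h).2 = b -> (val (side_edge h), b) = val h.
  by move=> <-; rewrite [RHS]surjective_pairing.
split=> [tq|[tq sl]]; split; [exact: tq.1| |exact: tq|] => [h|e].
  have [k ek] := turned_lab tq (side_edge h) (val h).2; exists k.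
  by rewrite [LHS]ek edgeE // at_side_val -at_side_rev.
have [h he] := ex_side e; have {he} he : e = side_edge h by apply: val_inj.
subst e; have [k ek] := sl h; rewrite -(at_side_rev q) -(at_side_val q h) in ek.
have edgeN b : (val h).2 = b -> (val (side_edge h), ~~ b) = Defs.rev (val h).
  by move=> <-.
have arith (x y a b c : int) : (- 1 - x = - 1 - y + a - b + c ->
    x = y + b - a - c)%R by lia.
case hb: (val h).2.
  by exists k; move: ek; rewrite /slab hb (edgeE _ _ hb) (edgeN _ hb).
exists (- k)%R; rewrite (edgeE _ _ hb) (edgeN _ hb) mulNr; apply: arith.
by rewrite -!olab_neg /=; move: ek; rewrite /slab hb.
Qed.

Lemma induced_iso_turned r K (wK : whole K) (m m' : marking r K) : 0 < r ->
  Lstruct_iso (induced wK m) (induced wK m') <-> turned m m'.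
Proof.
move=> r_gt0.
have crit := Lstruct_iso_values r_gt0 (@position_induced r K wK m)
  (@position_induced r K wK m') (@inner_value_induced r K wK m)
  (@inner_value_induced r K wK m') (@outer_value_induced r K wK m)
  (@outer_value_induced r K wK m').
have degE (m1 : marking r K) f :
    (Ldeg (induced wK m1) (Avert f)).+1 = size (face_sides m1 f).
  exact: size_face_sides.
have inner (q : side K -> int) h : side_inv h != h ->
    (exists k : int, (induced_inner_value m h - induced_inner_value m (side_inv h) =
       induced_inner_value m' h + q h * 2
       - (induced_inner_value m' (side_inv h) + q (side_inv h) * 2)
       + k * (r%:Z * 2))%R) <->
    (exists k : int, (slab m' h = slab m h + q h
      - (if side_inv h == h then 0 else q (side_inv h)) + k * r%:Z)%R).
  move=> nh; rewrite (negbTE nh); rewrite side_inv_neq in nh.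
  have [a ea] := inner_value_diff m r_gt0 nh.
  have [b eb] := inner_value_diff m' r_gt0 nh.
  split=> -[k ek]; first by exists (k - b + a)%R; lia.
  by exists (k + b - a)%R; lia.
have outer (q : side K -> int) h : side_inv h = h ->
    (exists k : int, (induced_outer_value m h =
       induced_outer_value m' h + q h * 2 + k * (r%:Z * 2))%R) <->
    (exists k : int, (slab m' h = slab m h + q h
      - (if side_inv h == h then 0 else q (side_inv h)) + k * r%:Z)%R).
  move=> nh; rewrite nh eqxx.
  have nsr : ~~ is_side (Defs.rev (val h)) by rewrite -side_inv_neq nh eqxx.
  have [a ea] := outer_value_slab m r_gt0 nsr.
  have [b eb] := outer_value_slab m' r_gt0 nsr.
  split=> -[k ek]; first by exists (k + b - a)%R; lia.
  by exists (k - b + a)%R; lia.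
split=> [/crit[_ [t [q [qP inP exP]]]]|[t [q /turned_slab[qP sl]]]].
  exists t, q; apply/turned_slab; split=> h; first by rewrite -degE; exact: qP.
  have [nh|nh] := eqVneq (side_inv h) h.
    by have := (outer q h nh).1 (exP h nh); rewrite nh eqxx.
  by have := (inner q h nh).1 (inP h nh); rewrite (negbTE nh).
apply/crit; split=> [f|].
  by apply/succn_inj; rewrite !degE; apply: size_face_sides_eq.
exists t, q; split=> h; first by rewrite degE; exact: qP.
  by move=> nh; apply/(inner q h nh)/sl.
by move=> nh; apply/(outer q h nh)/sl.
Qed.

(** * Every structure is induced by a marking *)

(** Each half-edge map sends its own half-edge to the opposite one, so the two values reduce modulo
    2 to different elements of the edge. *)
Lemma inner_value_odd r G (A : Lstruct r G) a (h : halfedge G) :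
  inner_value A a -> ginv h != h ->
  exists x : int, (a (ginv h) - a h = 1 + x * 2)%R.
Proof.
move=> aP nh; pose e := gedge_of nh.
have he : h \in val e by rewrite set21.
have he' : ginv h \in val e by rewrite set22.
have val1 k (hk : k \in val e) : exists (c : 'I_(Ldeg A (Aedge e)).+1) (j : int),
    (a k = c%:Z + j * 2)%R /\ val (Lmu A (Aedge e) c) = ginv k.
  have [i hi] := Lmu_surj A k.
  have [j ej] := @wev_word_fun (Ldeg A _) (Ldeg A _) (fmap A (Ainc hk)) i.
  exists (@word_fun (Ldeg A _) (Ldeg A _) (fmap A (Ainc hk)) i), j; split.
    rewrite -(aP _ _ hk _ hi) /Lev ej; congr (_ + _ * _)%R.
    by rewrite -/(Ldeg A (Aedge e)) Ldeg_edge.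
  by rewrite [LHS](@Lmu_edge r G A k e hk i) hi eqxx.
have [c [j [-> mc]]] := val1 _ he; have [c' [j' [-> mc']]] := val1 _ he'.
have ncc : c != c' :> nat.
  apply/eqP => /ord_inj ecc; rewrite ecc mc' ginvK in mc.
  by have := nh; rewrite -mc eqxx.
have lt2 (d : 'I_(Ldeg A (Aedge e)).+1) : d < 2.
  by rewrite -[X in _ < X.+1](@Ldeg_edge r G A e).
have := lt2 c; have := lt2 c'.
move: (c : nat) (c' : nat) ncc => {c mc c' mc'} c c' ncc lc' lc.
have [[-> ->]|[-> ->]] : (c' = 1 /\ c = 0) \/ (c' = 0 /\ c = 1) by lia.
- by exists (j' - j)%R; lia.
- by exists (j' - j - 1)%R; lia.
Qed.

Lemma outer_value_parity r G (A : Lstruct r G) a (h : halfedge G) :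
  outer_value A a -> ginv h = h ->
  exists x : int, (a h = (incoming h)%:Z + x * 2)%R.
Proof.
move=> aP /eqP nh; pose x : external G := exist (fun h => ginv h == h) _ nh.
have [i hi] := Lmu_surj A h.
have [j ej] := @wev_word_fun (Ldeg A _) (Ldeg A _) (fmap A (Aincx x)) i.
exists j; rewrite -(aP x i hi) /Lev ej -/(Ldeg A (Aext x));
  congr (Posz _ + _ * _)%R; last first.
  by rewrite Ldeg_ext.
have := @Lmu_extE r G A x i; rewrite hi eqxx addTb negbK Lmu_ext => <- //.
Qed.

Lemma Ldeg_vert r G (A : Lstruct r G) v :
  (Ldeg A (Avert v)).+1 = #|[pred h : halfedge G | gsrc h == v]|.
Proof.
have bij := @Lmu_bij r G A (Avert v); rewrite -[LHS]card_ord.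
rewrite (bij_eq_card (bij : @bijective {h | gsrc h == v} 'I_(Ldeg A (Avert v)).+1 _)).
by rewrite card_sig.
Qed.

Lemma iter_ordS n k : k <= n -> iter k (@ordS n.+1) ord0 = k :> nat.
Proof.
elim: k => // k IHk ltk; rewrite iterS /= IHk ?(ltnW ltk) //.
by rewrite modn_small.
Qed.

(** Two enumerations that follow the same cyclic successor and start at the same side coincide. *)
Lemma cyclic_position r K (wK : whole K) (A : Lstruct r (dual_graph wK))
  (m : marking r K) :
  Lstruct_cyclic (G := dual_graph wK) (@dual_cyc K) A ->
  (forall f, mark m f = val (val (Lmu_vert A f ord0))) ->
  position A (side_index m).
Proof.
move=> cycA mkA f i.
have deg : Ldeg A (Avert f) = Ldeg (induced wK m) (Avert f).
  by apply: succn_inj; rewrite !Ldeg_vert.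
have E k : val (Lmu_vert A f (iter k (@ordS _) ord0)) =
    val (Lmu_vert (induced wK m) f (iter k (@ordS _) ord0)).
  elim: k => [|k IHk]; last by rewrite !iterS cycA (@induced_cyclic r K wK m) IHk.
  set h := val (Lmu_vert A f ord0); have hf : side_face h = f.
    by apply/eqP; exact: (valP (Lmu_vert A f ord0)).
  apply/eqP; rewrite eq_sym [_ == h](tnth_face_sides wK) //.
  suff -> : index h (face_sides m f) = 0 by [].
  rewrite /face_sides mkA -/h /sides_from /orbit -orderSpred /= insubT ?(valP h) //.
  move=> vh /=; have -> : Sub (val h) vh = h by apply: val_inj; rewrite SubK.
  by rewrite eqxx.
have lei : i <= Ldeg A (Avert f) by rewrite -ltnS.
have ei : i = iter i (@ordS _) ord0 by apply: ord_inj; rewrite iter_ordS.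
rewrite [in LHS]ei E [LHS](@position_induced r K wK m).
by apply: iter_ordS; rewrite -/(Ldeg (induced wK m) _) -deg.
Qed.

(** Marks are the first sides in the enumerations of [A], orientations are the reference directions,
    and labels are solved from the values of [A]. Positions then agree outright, so the isomorphism
    needs no vertex translations. *)
Lemma induced_surj r K (wK : whole K) (A : Lstruct r (dual_graph wK)) : 0 < r ->
  Lstruct_cyclic (G := dual_graph wK) (@dual_cyc K) A ->
  exists m, Lstruct_iso (induced wK m) A.
Proof.
move=> r_gt0 cycA.
have [a aP] := inner_value_exists A; have [a' aP'] := outer_value_exists A.
pose inner_cond (h : side K) (x : int) :=
  side_inv h != h -> exists k : int,
    (a (side_inv h) - a h = 1 + x * 2 + k * (r%:Z * 2))%R.
pose outer_cond (h : side K) (x : int) :=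
  side_inv h = h -> exists k : int, (a' h = outer_shift h - x * 2 + k * (r%:Z * 2))%R.
have val_ex h : exists x : int, inner_cond h x /\ outer_cond h x.
  have [nh|nh] := eqVneq (side_inv h) h.
    have [x ex] := @outer_value_parity r (dual_graph wK) A a' h aP' nh.
    (* With [x] given by the parity statement, this solves the equation of [outer_cond] both for
       ingoing and for outgoing edges. *)
    exists (- 1 - x)%R; split=> [|_].
      by rewrite /inner_cond nh eqxx.
    by exists 0%R; rewrite ex /outer_shift /=; case: ingoing_side => /=; lia.
  have [x ex] := @inner_value_odd r (dual_graph wK) A a h aP nh.
  exists x; split=> [_|e]; last by rewrite e eqxx in nh.
  by exists 0%R; rewrite ex; lia.
(* One label has to serve both sides of an edge. It is read off at one side [h0]; the equation at
   the opposite side is the negative of that at [h0], and is solved by [-1 - x], the same label seen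
   from there. *)
have /fin_all_exists[l lP] (e : Kbar1 K) : exists y : Zmod r, forall h,
    (val h).1 = val e -> let x := (if (val h).2 then y%:Z else - y%:Z - 1)%R in
    inner_cond h x /\ outer_cond h x.
  have [h0 h0e] := ex_side e; have [x [x1 x2]] := val_ex h0.
  have [y [j ej]] := Zmod_of_int (if (val h0).2 then x else - x - 1)%R r_gt0.
  exists y => h he /=; have [->|hh0] := eqVneq h h0.
    split=> nh; [have [k ek] := x1 nh|have [k ek] := x2 nh]; rewrite ek ej.
      by case: (val h0).2; [exists (k - j)%R|exists (k + j)%R]; lia.
    by case: (val h0).2; [exists (k + j)%R|exists (k - j)%R]; lia.
  have bhh0 : (val h).2 = ~~ (val h0).2.
    apply/eqP; apply: contraNT hh0 => hb; apply/eqP/val_inj.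
    rewrite [LHS]surjective_pairing [RHS]surjective_pairing he h0e; congr pair.
    by case: (val h).2 (val h0).2 hb => [] [].
  have vh : val h = Defs.rev (val h0).
    by rewrite [LHS]surjective_pairing he -h0e bhh0.
  have sr : is_side (Defs.rev (val h0)) by rewrite -vh (valP h).
  have hE : h = side_inv h0 by apply: val_inj; rewrite side_inv_val sr.
  have ihE : side_inv h = h0 by rewrite hE side_invK.
  have nh0 : side_inv h0 != h0 by rewrite side_inv_neq.
  split=> nh; last by rewrite -nh ihE eqxx in hh0.
  have [k ek] := x1 nh0; rewrite ihE bhh0; rewrite -hE in ek.
  have arith (b c d : int) : (b - c = d -> c - b = - d)%R by lia.
  rewrite (arith _ _ _ ek) ej.
  by case: (val h0).2 => /=; [exists (- k + j)%R|exists (- k - j)%R]; lia.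
have left_markA f : left ([ffun f => val (val (Lmu_vert A f ord0))] f) = inl f.
  rewrite ffunE side_faceP; congr inl.
  by apply/eqP; exact: (valP (Lmu_vert A f ord0)).
pose m : marking r K := @Marking r K [ffun=> true] (finfun l) _ left_markA.
exists m.
have slabE h : slab m h =
    (if (val h).2 then (l (side_edge h))%:Z else - (l (side_edge h))%:Z - 1)%R.
  by rewrite /slab /olab !ffunE; case: (val h).2.
have posA : position A (side_index m).
  by apply: cyclic_position => // f; rewrite ffunE.
apply/(Lstruct_iso_values r_gt0 (@position_induced r K wK m) posA
  (@inner_value_induced r K wK m) aP
  (@outer_value_induced r K wK m) aP').
split; first by move=> f; apply: succn_inj; rewrite !Ldeg_vert.
exists (fun=> 0%R), (fun=> 0%R); split=> h; first by rewrite mul0r.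
- move=> nh; have [inn _] := lP (side_edge h) h erefl.
  rewrite -slabE in inn; have [k ek] := inn nh.
  have sr : is_side (Defs.rev (val h)) by rewrite -side_inv_neq.
  have [j ej] := inner_value_diff m r_gt0 sr; exists (k - j)%R.
  have arith (b c d e x y z : int) : (b - c = 1 + x + y -> d - e = 1 + x + z ->
    e - d = c + 0 * 2 - (b + 0 * 2) + (y - z))%R by lia.
  by rewrite (arith _ _ _ _ _ _ _ ek ej) mulrBl.
- move=> nh; have [_ out] := lP (side_edge h) h erefl.
  rewrite -slabE in out; have [k ek] := out nh.
  have nsr : ~~ is_side (Defs.rev (val h)) by rewrite -side_inv_neq; apply/negPn/eqP.
  have [j ej] := outer_value_slab m r_gt0 nsr; exists (j - k)%R.
  by rewrite ej ek; lia.
Qed.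

(** * The bijection *)

Lemma quot_eq (T : Type) (R : T -> T -> Prop) (C D : quot R) :
  (forall x, sval C x <-> sval D x) -> C = D.
Proof.
case: C D => C C1 [D D1] /= CD; have {}CD : C = D.
  by apply: functional_extensionality => x; apply: propositional_extensionality.
by subst D; congr exist; apply: proof_irrelevance.
Qed.

Theorem proposition3p2p14 (r : nat) (r_gt0 : 0 < r) (K : surface)
    (wK : whole K) (openK : open_parametrization K) (admK : admissible K)
    (punctK : puncture K = [set v | ~~ boundary_vertex v]) :
  exists f : quot (@sim_fix r K) -> quot (@sim_iso r K wK),
    (forall m : marking r K, f (class _ m) = class _ (inducedS wK m)) /\
    bijective f.
Proof.
have iso_sim (m m' : marking r K) :
    sim_iso (inducedS wK m) (inducedS wK m') <-> sim_fix m m'.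
  split=> [/(induced_iso_turned _ _ _ r_gt0)/(sim_turned wK r_gt0) //|].
  by move/(turned_sim r_gt0)/(induced_iso_turned wK _ _ r_gt0).
have surj (A : LstructS r wK) : exists m, sim_iso (inducedS wK m) A.
  by case: A => A cycA; apply: induced_surj.
have isoT (A B C : LstructS r wK) : sim_iso A B -> sim_iso B C -> sim_iso A C.
  exact: Lstruct_iso_trans.
have isoS (A B : LstructS r wK) : sim_iso A B -> sim_iso B A.
  exact: Lstruct_iso_sym.
(* No representatives are chosen: a class of markings goes to the set of all structures isomorphic
   to one induced by a member, and the inverse map takes a class of structures to its preimage. *)
have clsF (C : quot (@sim_fix r K)) : exists A,
    (fun B => exists m, sval C m /\ sim_iso (inducedS wK m) B) = @sim_iso r K wK A.
  case: C => C p /=; case: p => m ->; exists (inducedS wK m).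
  apply: functional_extensionality => B; apply: propositional_extensionality.
  split=> [[m' [mm' m'B]]|mB]; last by exists m; split=> //; apply: rst_refl.
  by apply: isoT m'B; apply/iso_sim.
have clsG (D : quot (@sim_iso r K wK)) : exists m,
    (fun m' => sval D (inducedS wK m')) = @sim_fix r K m.
  case: D => D p /=; case: p => A ->; have [m mA] := surj A; exists m.
  apply: functional_extensionality => m'; apply: propositional_extensionality.
  split=> [Am'|mm']; first by apply/iso_sim; apply: isoT mA Am'.
  by apply: isoT (isoS _ _ mA) _; apply/iso_sim.
pose f C : quot (@sim_iso r K wK) := exist _ _ (clsF C).
pose g D : quot (@sim_fix r K) := exist _ _ (clsG D).
exists f; split.
  move=> m; apply: quot_eq => B /=; split=> [[m' [mm' m'B]]|mB].
    by apply: isoT m'B; apply/iso_sim.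
  by exists m; split=> //; apply: rst_refl.
exists g => [C|D]; apply: quot_eq => x /=.
  case: C => C p /=; case: p => m ->; split=> [[m' [mm' m'x]]|mx].
    by apply: sim_fix_trans mm' _; apply/iso_sim.
  by exists x; split=> //; apply/iso_sim; apply: rst_refl.
case: D => D p /=; case: p => A ->; split=> [[m [Am mx]]|Ax]; first exact: isoT mx.
have [m mx] := surj x; exists m; split=> //.
by apply: isoT Ax _; apply: isoS.
Qed.
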